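(* Let $A=Ke\oplus U\oplus V$ be a Banach Bernstein algebra over $K=\mathbb{R}$ or $\mathbb{C}$. The following assertions are equivalent: (i) the algebra $A$ is algebraic; (ii) the operators $L_v:U\to U$ are algebraic for all $v\in V$; (iii) the algebra $A$ is algebraic of bounded degree; (iv) the operators $L_v:U\to U$ are algebraic for all $v\in V$ and their degrees are bounded collectively.
   Context: Algebras are not assumed associative, unital or finite-dimensional. A Bernstein algebra over $K$ is a commutative $K$-algebra $A$ with a nonzero algebra homomorphism $\omega:A\to K$ satisfying $(x^2)^2=\omega(x)^2x^2$ for all $x$. A Banach Bernstein algebra is a Bernstein algebra over $\mathbb{R}$ or $\mathbb{C}$ equipped with a norm making it a (nonassociative) Banach algebra, i.e. a complete norm with $\|xy\|\le\|x\|\,\|y\|$. Here $e$ is a nonzero idempotent of $A$ (necessarily $\omega(e)=1$) and $A=Ke\oplus U\oplus V$ is the Peirce decomposition: $U=\{u\in A:2eu=u\}$, $V=\{v\in A:ev=0\}$; one has $UV\subseteq U$, so $L_v(u)=vu$ defines $L_v:U\to U$ for $v\in V$. An element $a$ is algebraic of degree $\dim\mathrm{alg}(a)$ if the subalgebra $\mathrm{alg}(a)$ generated by $a$ is finite-dimensional; $A$ is algebraic if all elements are algebraic, and algebraic of bounded degree if moreover the degrees are bounded by a common integer. A linear operator $T$ is algebraic if $P(T)=0$ for some nonzero $P\in K[X]$; its degree is the least degree of such $P$. *)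

(* Defs.v *)
From HB Require Import structures.
From mathcomp Require Import all_boot all_order all_algebra.
From mathcomp Require Import sesquilinear complex.
From mathcomp Require Import all_classical all_reals all_analysis.

Set Implicit Arguments.
Unset Strict Implicit.
Unset Printing Implicit Defensive.

Import Order.TTheory GRing.Theory Num.Theory.
Import numFieldNormedType.Exports.

Local Open Scope classical_set_scope.
Local Open Scope ring_scope.

(* MathComp's algebra structures are associative, so the product of a
   nonassociative algebra is a bilinear map [mul] on a left module. *)

Record is_bernstein (K : fieldType) (A : lmodType K)
    (mul : {bilinear A -> A -> A}) (omega : {scalar A}) : Prop := IsBernstein {
  bernstein_mulC : commutative mul;
  bernstein_weightM : forall x y, omega (mul x y) = omega x * omega y;
  bernstein_weight_neq0 : exists x, omega x != 0;
  bernstein_identity : forall x,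
    mul (mul x x) (mul x x) = omega x ^+ 2 *: mul x x }.

(* Completeness of the norm is part of [completeNormedModType]. *)
Record is_banach_bernstein (K : numFieldType) (A : completeNormedModType K)
    (mul : {bilinear A -> A -> A}) (omega : {scalar A}) : Prop :=
  IsBanachBernstein {
    banach_bernstein_bernstein : is_bernstein mul omega;
    banach_bernstein_normM : forall x y, `|mul x y| <= `|x| * `|y| }.

Section LinearAlgebra.
Context {K : fieldType} {A : lmodType K}.

Definition has_dim (W : set A) (n : nat) : Prop :=
  exists b : 'I_n -> A,
    [/\ forall i, W (b i),
        forall c : 'I_n -> K,
          \sum_(i < n) c i *: b i = 0 -> forall i, c i = 0 &
        forall x, W x -> exists c : 'I_n -> K, x = \sum_(i < n) c i *: b i].

Definition poly_op (P : {poly K}) (T : A -> A) (x : A) : A :=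
  \sum_(i < size P) P`_i *: iter i T x.

(* [W] is meant to be a [T]-stable subspace: the following say that the
   operator [W -> W] induced by [T] is annihilated by [P], is algebraic, is
   algebraic of degree [d]. *)
Definition annihilates_on (W : set A) (T : A -> A) (P : {poly K}) : Prop :=
  forall x, W x -> poly_op P T x = 0.

Definition algebraic_op_on (W : set A) (T : A -> A) : Prop :=
  exists P : {poly K}, P != 0 /\ annihilates_on W T P.

(* For [P != 0], the degree of [P] is [(size P).-1]. *)
Definition op_degree_on (W : set A) (T : A -> A) (d : nat) : Prop :=
  (exists P : {poly K},
     [/\ P != 0, annihilates_on W T P & (size P).-1 = d]) /\
  (forall P : {poly K},
     P != 0 -> annihilates_on W T P -> (d <= (size P).-1)%N).

End LinearAlgebra.

Section NonassociativeAlgebra.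
Context {K : fieldType} {A : lmodType K}.
Variable mul : {bilinear A -> A -> A}.

Definition is_subalgebra (B : set A) : Prop :=
  [/\ B 0,
      forall x y, B x -> B y -> B (x + y),
      forall (c : K) x, B x -> B (c *: x) &
      forall x y, B x -> B y -> B (mul x y)].

Definition alg (a : A) : set A := smallest is_subalgebra [set a].

Definition algebraic_elt (a : A) : Prop := exists n, has_dim (alg a) n.

Definition algebraic_algebra : Prop := forall a, algebraic_elt a.

Definition algebraic_algebra_bounded : Prop :=
  algebraic_algebra /\
  exists N : nat, forall a n, has_dim (alg a) n -> (n <= N)%N.

Definition peirceU (e : A) : set A := [set u | 2%:R *: mul e u = u].

Definition peirceV (e : A) : set A := [set v | mul e v = 0].

Definition peirce_ops_algebraic (e : A) : Prop :=
  forall v, peirceV e v -> algebraic_op_on (peirceU e) (mul v).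

Definition peirce_ops_algebraic_bounded (e : A) : Prop :=
  peirce_ops_algebraic e /\
  exists N : nat, forall v, peirceV e v ->
    forall d, op_degree_on (peirceU e) (mul v) d -> (d <= N)%N.

End NonassociativeAlgebra.

Section Peirce.
Context {K : numFieldType} {A : lmodType K}.
Context (mul : {bilinear A -> A -> A}) (omega : {scalar A}) (e : A).
Context (bern : is_bernstein mul omega) (e_neq0 : e != 0) (ee : mul e e = e).

Let double_inj : injective (fun x : A => x *+ 2).
Proof.
move=> x y /eqP; rewrite -subr_eq0 -mulrnBl -scaler_nat scaler_eq0 pnatr_eq0 /=.
by rewrite subr_eq0 => /eqP.
Qed.

Let sqrD x y : mul (x + y) (x + y) = mul x x + mul x y *+ 2 + mul y y.
Proof.
by rewrite linearDl !linearD /= (bernstein_mulC bern y x) mulr2n !addrA.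
Qed.

Lemma weight_idempotent : omega e = 1.
Proof.
have we2 : omega e ^+ 2 = omega e by rewrite expr2 -(bernstein_weightM bern) ee.
have /eqP := bernstein_identity bern e; rewrite !ee we2 -{1}[e]scale1r.
by rewrite -subr_eq0 -scalerBl scaler_eq0 (negPf e_neq0) orbF subr_eq0 => /eqP.
Qed.

Lemma weight_peirceU u : peirceU mul e u -> omega u = 0.
Proof.
move=> uU; have: omega u = omega u *+ 2.
  rewrite -{1}uU linearZ /= (bernstein_weightM bern) weight_idempotent mul1r.
  by rewrite mulr_natl.
by rewrite mulr2n -{1}[omega u]addr0 => /addrI.
Qed.

Lemma weight_peirceV v : peirceV mul e v -> omega v = 0.
Proof.
move=> vV; rewrite -[omega v]mul1r -weight_idempotent -(bernstein_weightM bern).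
by rewrite vV linear0.
Qed.

Let weight0_sqr b : omega b = 0 ->
  mul e (mul b b) *+ 2 + mul (mul e b *+ 2) (mul e b *+ 2) = mul b b.
Proof.
move=> wb; set p := mul e b *+ 2; set q := mul b b.
have we := weight_idempotent.
have HD : mul (e + q + p) (e + q + p) = e + q + p.
  have := bernstein_identity bern (e + b).
  by rewrite sqrD ee [omega (e + b)]linearD wb we addr0 expr1n scale1r addrAC.
have HB : mul (e + q - p) (e + q - p) = e + q - p.
  have := bernstein_identity bern (e - b).
  rewrite sqrD ee [omega (e - b)]linearB wb we subr0 expr1n scale1r.
  by rewrite !linearN /= linearNl /= opprK mulNrn addrAC.
have H : mul (e + q) (e + q) + mul p p = e + q.
  apply: double_inj; rewrite /= !mulr2n.
  have: mul (e + q + p) (e + q + p) + mul (e + q - p) (e + q - p)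
      = (e + q + p) + (e + q - p) by rewrite HD HB.
  rewrite (sqrD (e + q) p) (sqrD (e + q) (- p)).
  rewrite !linearN /= linearNl /= opprK mulNrn.
  rewrite [e + q + p + _]addrACA subrr addr0 => <-.
  rewrite [_ + mul (e + q) p *+ 2 + _]addrAC [_ - mul (e + q) p *+ 2 + _]addrAC.
  by rewrite [RHS]addrACA subrr addr0.
have qq : mul q q = 0 by rewrite (bernstein_identity bern) wb expr0n scale0r.
by move: H; rewrite sqrD ee qq addr0 -addrA => /addrI.
Qed.

(* For [v] in [V], left multiplication by [v] is an operator on [U]. *)
Lemma peirce_mulVU v u :
  peirceV mul e v -> peirceU mul e u -> peirceU mul e (mul v u).
Proof.
move=> vV uU; have wu := weight_peirceU uU; have wv := weight_peirceV vV.
have uU2 : mul e u *+ 2 = u by rewrite -scaler_nat.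
have Hu := weight0_sqr wu; rewrite uU2 in Hu.
have Hv := weight0_sqr wv; rewrite vV mul0rn linear0 addr0 in Hv.
have wuv : omega (u + v) = 0 by rewrite linearD /= wu wv addr0.
have := weight0_sqr wuv.
rewrite [mul e (u + v)]linearD /= vV addr0 uU2 sqrD !linearD /= !mulrnDl Hv.
rewrite addrAC => /addIr; rewrite addrAC Hu => /addrI.
rewrite -mulr2n => /double_inj; rewrite (bernstein_mulC bern u v).
by rewrite /peirceU /= scaler_nat.
Qed.

End Peirce.

(* Main.v *)
(* Write [L_v] for the multiplication by [v], with [u] in [U] and [v] in [V].
   The Bernstein identity gives [u (u' v) = - (u v) u'], [u (v v') = 0],
   [(u v)^2 = 0] and [u^3 = 0].  It follows that the principal powers of
   [a = u + v] are [a^(k + 3) = L_v^k (L_v (u^2) + 2 L_v^2 u + L_v (v^2))];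
   comparing the elements [u + v], [- u + v] and [v] shows that, when [A] is
   algebraic, every [u] is killed by a nonzero polynomial in [L_v].  Conversely,
   [e + u + v] lies in the subalgebra spanned by [e], [v], [u^2] and the orbits
   under [L_v] of [u], [v^2] and [v u^2].  Everything thus reduces to bounding
   the dimension of the [L_v]-orbit of [u] uniformly in [u] and [v].  Linear
   independence of [u], [L_v u], ..., [L_v^(n-1) u] is an open condition on
   [u + v], because finite-dimensional subspaces are closed, and on an affine
   line it either never holds or holds outside finitely many points; a Baire
   category argument then gives the uniform bound. *)

Require Import Defs.
From HB Require Import structures.
From mathcomp Require Import all_boot all_order all_algebra.
From mathcomp Require Import sesquilinear complex.
From mathcomp Require Import all_classical all_reals all_analysis.

Set Implicit Arguments.
Unset Strict Implicit.
Unset Printing Implicit Defensive.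

Import Order.TTheory GRing.Theory Num.Theory.
Import numFieldNormedType.Exports.

Local Open Scope ring_scope.

(** * Independent and spanning families of vectors *)

Section Independence.
Context {K : fieldType} {A : lmodType K}.
Implicit Types (b x : nat -> A) (c : nat -> K).

(** Families are indexed by all of [nat] and cut at [n], so that prefixes and one-vector extensions
    need no change of index type. *)
Definition indep n b : Prop :=
  forall c, \sum_(i < n) c i *: b i = 0 -> forall i, (i < n)%N -> c i = 0.

Definition spanned n b (y : A) : Prop :=
  exists c, y = \sum_(i < n) c i *: b i.

Lemma indepPn n b : ~ indep n b ->
  exists c, \sum_(i < n) c i *: b i = 0 /\ exists2 i, (i < n)%N & c i != 0.
Proof.
move=> /existsNP[c /not_implyP[c0 /existsNP[i /not_implyP[ltin cin]]]].
by exists c; split=> //; exists i => //; apply/eqP.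
Qed.

Lemma eq_indep n b b' : (forall i, (i < n)%N -> b i = b' i) ->
  indep n b -> indep n b'.
Proof.
move=> eqb ib c c0; apply: ib; rewrite -[RHS]c0.
by apply: eq_bigr => i _; rewrite eqb.
Qed.

Lemma indep_le m n b : (m <= n)%N -> indep n b -> indep m b.
Proof.
move=> lemn ib c c0 i ltim.
have := ib (fun j => if (j < m)%N then c j else 0) _ i (leq_trans ltim lemn).
rewrite ltim; apply; rewrite -[RHS]c0 (big_ord_widen n (fun j => c j *: b j)) //.
rewrite [RHS]big_mkcond /=; apply: eq_bigr => j _.
by case: ifP => // _; rewrite scale0r.
Qed.

Lemma indepS n b : indep n b -> ~ spanned n b (b n) -> indep n.+1 b.
Proof.
move=> ib nb c; rewrite big_ord_recr /= => c0.
have cn : c n = 0.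
  apply: contra_notP nb => /eqP cn; exists (fun i => - (c n)^-1 * c i).
  have /eqP := c0; rewrite addrC addr_eq0 => /eqP/(congr1 (fun z => (c n)^-1 *: z)).
  rewrite scalerA mulVf // scale1r => ->.
  rewrite scalerN scaler_sumr -sumrN; apply: eq_bigr => i _.
  by rewrite mulNr scaleNr scalerA.
rewrite cn scale0r addr0 in c0.
by move=> i; rewrite ltnS leq_eqVlt => /predU1P[->//|]; apply: ib.
Qed.

Lemma spanned0 n b : spanned n b 0.
Proof. by exists (fun=> 0); rewrite big1 // => i _; rewrite scale0r. Qed.

Lemma spannedD n b y z : spanned n b y -> spanned n b z -> spanned n b (y + z).
Proof.
move=> [c ->] [d ->]; exists (fun i => c i + d i).
by rewrite -big_split; apply: eq_bigr => i _; rewrite scalerDl.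
Qed.

Lemma spannedZ n b k y : spanned n b y -> spanned n b (k *: y).
Proof.
move=> [c ->]; exists (fun i => k * c i).
by rewrite scaler_sumr; apply: eq_bigr => i _; rewrite scalerA.
Qed.

Lemma spanned_sum n b (I : Type) (r : seq I) (P : pred I) (F : I -> A) :
  (forall i, P i -> spanned n b (F i)) -> spanned n b (\sum_(i <- r | P i) F i).
Proof. by apply: big_ind; [exact: spanned0 | exact: spannedD]. Qed.

Lemma spanned_mem n b i : (i < n)%N -> spanned n b (b i).
Proof.
move=> ltin; exists (fun j => (j == i)%:R).
rewrite (bigD1 (Ordinal ltin)) //= eqxx scale1r big1 ?addr0 // => j.
by rewrite -val_eqE /= => /negPf ->; rewrite scale0r.
Qed.

Lemma spanned_trans m n b x y :
  (forall i, (i < m)%N -> spanned n b (x i)) -> spanned m x y -> spanned n b y.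
Proof.
by move=> xb [c ->]; apply: spanned_sum => i _; apply/spannedZ/xb.
Qed.

(** Run through the vectors, appending [x m] only when the family built so far does not span it. *)
Lemma exists_basis m x : exists r b,
  indep r b /\ forall i, (i < m)%N -> spanned r b (x i).
Proof.
elim: m => [|m [r [b [ib bx]]]]; first by exists 0%N, x.
have [xm|xm] := pselect (spanned r b (x m)).
  exists r, b; split=> // i; rewrite ltnS leq_eqVlt => /predU1P[->//|]; exact: bx.
pose b' i := if (i < r)%N then b i else x m.
have bb' i : (i < r)%N -> b i = b' i by rewrite /b' => ->.
have sb' y : spanned r b y -> spanned r b' y.
  by move=> [c ->]; exists c; apply: eq_bigr => i _; rewrite bb'.
have xm' : b' r = x m by rewrite /b' ltnn.
have sub y : spanned r b' y -> spanned r.+1 b' y.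
  apply: spanned_trans => i ltir.
  by apply: spanned_mem; rewrite ltnS ltnW.
exists r.+1, b'; split.
  apply: indepS; first exact: eq_indep ib.
  rewrite xm' => -[c xmE]; apply: xm; exists c; rewrite xmE.
  by apply: eq_bigr => i _; rewrite bb'.
move=> i; rewrite ltnS leq_eqVlt => /predU1P[->|/bx/sb'/sub//].
by rewrite -xm'; apply: spanned_mem.
Qed.

(** The rows of [M] are coordinates in [b], so independence of the rows' vectors means that [M] has
    trivial left kernel. The value [0] beyond [n] is a mere default. *)
Lemma matrix_indep n r b (M : 'M[K]_(n, r)) : indep r b ->
  indep n (fun i => if insub i is Some i' then \sum_j M i' j *: b j else 0) <->
  row_free M.
Proof.
move=> ib.
have sumE c : \sum_(i < n) c i *: (if insub (val i) is Some i'
      then \sum_j M i' j *: b j else 0) =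
    \sum_(j < r) ((\row_i c (val i)) *m M) 0 j *: b j.
  under eq_bigr => i _ do rewrite valK scaler_sumr.
  rewrite exchange_big; apply: eq_bigr => j _; rewrite mxE scaler_suml.
  by apply: eq_bigr => i _; rewrite mxE scalerA.
split=> [iM|/row_freeP[B MB]].
  apply: inj_row_free => v v0; apply/rowP => i; rewrite mxE.
  pose c k := if insub k is Some k' then v 0 k' else 0.
  have vE : v = \row_i c (val i) by apply/rowP => k; rewrite mxE /c valK.
  have := iM c; rewrite sumE -vE v0 => /(_ _ i (ltn_ord i)).
  by rewrite /c valK; apply; rewrite big1 // => j _; rewrite mxE scale0r.
move=> c; rewrite sumE => c0 i ltin.
pose v := \row_i c (val i) *m M.
pose d k := if insub k is Some k' then v 0 k' else 0.
have v0 : v = 0.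
  apply/rowP => j; rewrite [RHS]mxE.
  have := ib d _ j (ltn_ord j); rewrite /d valK; apply.
  by rewrite -[RHS]c0; apply: eq_bigr => k _; rewrite valK.
have /rowP/(_ (Ordinal ltin)) : \row_(i < n) c (val i) = 0.
  by rewrite -[LHS]mulmx1 -MB mulmxA -/v v0 mul0mx.
by rewrite !mxE.
Qed.

(** In an independent family spanning every [x i], the coordinate matrix of [b] factors through [m]
    coordinates, so its rank [n] is at most [m]. *)
Lemma steinitz m n b x :
  indep n b -> (forall i, (i < n)%N -> spanned m x (b i)) -> (n <= m)%N.
Proof.
move=> ib bx.
have [r [y [iy xy]]] := exists_basis m x.
have /choice[C CE] : forall i, exists c : nat -> K,
    (i < n)%N -> b i = \sum_(j < m) c j *: x j.
  move=> i; have [/bx[c ->]|] := ltnP i n; first by exists c.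
  by exists (fun=> 0).
have /choice[D DE] : forall i, exists c : nat -> K,
    (i < m)%N -> x i = \sum_(j < r) c j *: y j.
  move=> i; have [/xy[c ->]|] := ltnP i m; first by exists c.
  by exists (fun=> 0).
pose M : 'M[K]_(n, r) :=
  (\matrix_(i < n, j < m) C i j) *m (\matrix_(j < m, k < r) D j k).
have /(matrix_indep M iy) fM : indep n (fun i =>
    if insub i is Some i' then \sum_j M i' j *: y j else 0).
  apply: eq_indep ib => i ltin; rewrite insubT /= CE //.
  transitivity (\sum_(j < m) \sum_(k < r) (C i j * D j k) *: y k).
    apply: eq_bigr => j _; rewrite DE // scaler_sumr.
    by apply: eq_bigr => k _; rewrite scalerA.
  rewrite exchange_big; apply: eq_bigr => k _; rewrite mxE scaler_suml.
  by apply: eq_bigr => j _; rewrite !mxE.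
rewrite -(eqP fM); apply: leq_trans (mxrankM_maxl _ _) _.
exact: rank_leq_col.
Qed.

End Independence.

(** * Polynomial maps from scalars to vectors *)

Section PolynomialFamilies.
Context {K : fieldType} {A : lmodType K}.
Implicit Types (f g : K -> A).

Definition polyfun f : Prop :=
  exists d (c : nat -> A), forall t, f t = \sum_(k < d) t ^+ k *: c k.

Lemma eq_polyfun f g : (forall t, f t = g t) -> polyfun f -> polyfun g.
Proof. by move=> fg [d [c cE]]; exists d, c => t; rewrite -fg. Qed.

Lemma polyfun_mon k a : polyfun (fun t => t ^+ k *: a).
Proof.
exists k.+1, (fun i => if i == k then a else 0) => t.
rewrite big_ord_recr /= eqxx big1 ?add0r // => i _.
by rewrite ltn_eqF // scaler0.
Qed.

Lemma polyfun_cst a : polyfun (fun=> a).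
Proof. by apply: eq_polyfun (polyfun_mon 0 a) => t; rewrite expr0 scale1r. Qed.

Lemma polyfun_widen f d : (exists c : nat -> A, forall t, f t = \sum_(k < d) t ^+ k *: c k) ->
  forall d', (d <= d')%N -> exists c : nat -> A, forall t, f t = \sum_(k < d') t ^+ k *: c k.
Proof.
move=> [c cE] d' led; exists (fun k => if (k < d)%N then c k else 0) => t.
rewrite cE (big_ord_widen d' (fun k => t ^+ k *: c k)) // big_mkcond /=.
by apply: eq_bigr => k _; case: ifP => // _; rewrite scaler0.
Qed.

Lemma polyfunD f g : polyfun f -> polyfun g -> polyfun (fun t => f t + g t).
Proof.
move=> [d fd] [d' gd'].
have [c cE] := polyfun_widen fd (leq_maxl d d').
have [c' cE'] := polyfun_widen gd' (leq_maxr d d').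
exists (maxn d d'), (fun k => c k + c' k) => t; rewrite cE cE' -big_split.
by apply: eq_bigr => k _; rewrite scalerDr.
Qed.

Lemma polyfun_sum (I : Type) (r : seq I) (F : I -> K -> A) :
  (forall i, polyfun (F i)) -> polyfun (fun t => \sum_(i <- r) F i t).
Proof.
move=> pF; elim: r => [|i r IHr].
  by apply: eq_polyfun (polyfun_cst 0) => t; rewrite big_nil.
by apply: eq_polyfun (polyfunD (pF i) IHr) => t; rewrite big_cons.
Qed.

Lemma polyfunZ k f : polyfun f -> polyfun (fun t => k *: f t).
Proof.
move=> [d [c cE]]; exists d, (fun i => k *: c i) => t.
by rewrite cE scaler_sumr; apply: eq_bigr => i _; rewrite !scalerA mulrC.
Qed.

Lemma polyfun_mul (mul : {bilinear A -> A -> A}) f g :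
  polyfun f -> polyfun g -> polyfun (fun t => mul (f t) (g t)).
Proof.
move=> [d [c cE]] [d' [c' cE']].
apply: (@eq_polyfun (fun t => \sum_(i < d) \sum_(j < d')
   t ^+ (i + j) *: mul (c i) (c' j))).
  move=> t; rewrite cE cE' linear_sumlz; apply: eq_bigr => i _.
  rewrite linearZl_LR linear_sum /= scaler_sumr; apply: eq_bigr => j _.
  by rewrite linearZr_LR scalerA exprD.
by apply: polyfun_sum => i; apply: polyfun_sum => j; exact: polyfun_mon.
Qed.

(* Independence is the nonvanishing of some minor, which is polynomial in [t]. *)
Lemma indep_polyfun n (w : nat -> K -> A) (t0 : K) :
  (forall i, polyfun (w i)) -> indep n (fun i => w i t0) ->
  exists q : {poly K}, q.[t0] != 0 /\
    forall t, q.[t] != 0 -> indep n (fun i => w i t).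
Proof.
move=> pw iw.
have [d /choice[c cE]] : exists d, forall i, exists c : nat -> A,
    (i < n)%N -> forall t, w i t = \sum_(k < d) t ^+ k *: c k.
  have /choice[dd ddE] := pw.
  exists (\max_(i < n) dd i)%N => i; have [ltin|] := ltnP i n; last first.
    by exists (fun=> 0).
  have [|c cE] := polyfun_widen (ddE i) (d' := (\max_(i < n) dd i)%N).
    exact: (leq_bigmax (Ordinal ltin)).
  by exists c.
(* The double index is flattened by division, so that one basis serves all coefficient vectors
   [c i k]. *)
have [r [b [ib bc]]] := exists_basis (n * d) (fun k => c (k %/ d)%N (k %% d)%N).
have /choice[M ME] : forall i, exists m : nat -> nat -> K,
    forall k, (i < n)%N -> (k < d)%N -> c i k = \sum_(j < r) m k j *: b j.
  move=> i; have [ltin|] := ltnP i n; last by exists (fun _ _ => 0).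
  suff /choice[m mE] : forall k, exists m : nat -> K,
      (k < d)%N -> c i k = \sum_(j < r) m j *: b j by exists m => k _; exact: mE.
  move=> k; have [ltkd|] := ltnP k d; last by exists (fun=> 0).
  have d0 : (0 < d)%N by apply: leq_ltn_trans ltkd.
  have [|m] := bc (i * d + k)%N.
    by rewrite (leq_trans (n := i.+1 * d)) ?leq_mul2r ?ltin ?orbT // mulSnr ltn_add2l.
  rewrite divnMDl // modnMDl divn_small // modn_small // addn0 => cE'.
  by exists m.
pose P : 'M[{poly K}]_(n, r) := \matrix_(i, j) \poly_(k < d) M i k j.
pose W t : 'M[K]_(n, r) := map_mx (horner_eval t) P.
have wE t i : (i < n)%N -> w i t =
    if insub i is Some i' then \sum_j W t i' j *: b j else 0.
  move=> ltin; rewrite insubT /= cE //.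
  transitivity (\sum_(k < d) \sum_(j < r) (M i k j * t ^+ k) *: b j).
    apply: eq_bigr => k _; rewrite ME // scaler_sumr.
    by apply: eq_bigr => j _; rewrite scalerA mulrC.
  rewrite exchange_big; apply: eq_bigr => j _; rewrite !mxE /horner_eval.
  by rewrite horner_poly scaler_suml.
have iW t : indep n (fun i => w i t) <-> row_free (W t).
  rewrite -(matrix_indep (W t) ib); split; apply: eq_indep => i ltin;
  by rewrite wE.
have /iW/row_freeP[B WB] := iw.
(* [B] is a right inverse at [t0], so this determinant is 1 there; by Cauchy-Binet it is a
   combination of the maximal minors of [P]. *)
exists (\det (P *m map_mx polyC B)).
have qE t : (\det (P *m map_mx polyC B)).[t] = \det (W t *m B).
  rewrite -[LHS]/(horner_eval t _) -det_map_mx map_mxM -map_mx_comp.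
  by rewrite map_mx_id // => x; rewrite /= /horner_eval hornerC.
split; first by rewrite qE WB det1 oner_neq0.
move=> t; rewrite qE => nz; apply/iW; apply/row_freeP.
exists (B *m invmx (W t *m B)); rewrite mulmxA mulmxV //.
by rewrite unitmxE unitfE.
Qed.

End PolynomialFamilies.

(** * Polynomials in a linear operator, and cyclic orbits *)

Section PolyOp.
Context {K : fieldType} {A : lmodType K} (T : {linear A -> A}).
Implicit Types (P Q : {poly K}) (x y : A).

Lemma poly_op_widen n P x : (size P <= n)%N ->
  poly_op P T x = \sum_(i < n) P`_i *: iter i T x.
Proof.
move=> leP; rewrite /poly_op (big_ord_widen n (fun i => P`_i *: iter i T x)) //.
rewrite big_mkcond /=; apply: eq_bigr => i _; case: ltnP => // leiP.
by rewrite nth_default // scale0r.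
Qed.

Lemma iter_linear i k x y : iter i T (k *: x + y) = k *: iter i T x + iter i T y.
Proof. by elim: i => //= i ->; rewrite linearP. Qed.

Lemma poly_op_linear P k x y :
  poly_op P T (k *: x + y) = k *: poly_op P T x + poly_op P T y.
Proof.
rewrite /poly_op scaler_sumr -big_split; apply: eq_bigr => i _ /=.
by rewrite iter_linear scalerDr !scalerA mulrC.
Qed.

Lemma poly_op0r P : poly_op P T 0 = 0.
Proof.
by have := poly_op_linear P (-1) 0 0; rewrite scaler0 addr0 scaleN1r addNr.
Qed.

Lemma poly_opDr P x y : poly_op P T (x + y) = poly_op P T x + poly_op P T y.
Proof. by have := poly_op_linear P 1 x y; rewrite !scale1r. Qed.

Lemma poly_opZr P k x : poly_op P T (k *: x) = k *: poly_op P T x.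
Proof. by have := poly_op_linear P k x 0; rewrite poly_op0r !addr0. Qed.

Lemma poly_op_sumr P n (c : nat -> K) (b : nat -> A) :
  poly_op P T (\sum_(i < n) c i *: b i) = \sum_(i < n) c i *: poly_op P T (b i).
Proof.
elim: n => [|n IHn]; first by rewrite !big_ord0 poly_op0r.
by rewrite !big_ord_recr /= poly_opDr IHn poly_opZr.
Qed.

Lemma poly_opDl P Q x : poly_op (P + Q) T x = poly_op P T x + poly_op Q T x.
Proof.
pose n := maxn (size P) (size Q).
rewrite !(@poly_op_widen n) ?leq_maxl ?leq_maxr ?size_polyD // -big_split.
by apply: eq_bigr => i _; rewrite coefD scalerDl.
Qed.

Lemma poly_opZl P k x : poly_op (k *: P) T x = k *: poly_op P T x.
Proof.
rewrite (@poly_op_widen (size P)) ?size_scale_leq // scaler_sumr.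
by apply: eq_bigr => i _; rewrite coefZ scalerA.
Qed.

Lemma poly_op_mulX P x : poly_op (P * 'X) T x = poly_op P T (T x).
Proof.
rewrite (@poly_op_widen (size P).+1); last first.
  by have [->|P0] := eqVneq P 0; [rewrite mul0r size_poly0 | rewrite size_mulX].
rewrite big_ord_recl coefMX eqxx scale0r add0r; apply: eq_bigr => i _.
by rewrite lift0 coefMX iterSr.
Qed.

Lemma poly_op_comm P x : poly_op P T (T x) = T (poly_op P T x).
Proof.
rewrite /poly_op linear_sum; apply: eq_bigr => i _.
by rewrite linearZ /= -iterS iterSr.
Qed.

Lemma poly_op_iter P i x : poly_op P T (iter i T x) = iter i T (poly_op P T x).
Proof. by elim: i => //= i IHi; rewrite poly_op_comm IHi. Qed.

Lemma poly_opM P Q x : poly_op (P * Q) T x = poly_op P T (poly_op Q T x).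
Proof.
elim/poly_ind: P x => [|P c IHP] x; first by rewrite mul0r /poly_op size_poly0 !big_ord0.
have cE y : poly_op c%:P T y = c *: y.
  by rewrite (@poly_op_widen 1) ?size_polyC_leq1 // big_ord1 coefC.
rewrite mulrDl mulrAC !poly_opDl !poly_op_mulX IHP mul_polyC poly_opZl cE.
by rewrite poly_op_comm.
Qed.

Lemma poly_op_XnE n x : poly_op 'X^n T x = iter n T x.
Proof.
rewrite (@poly_op_widen n.+1) ?size_polyXn // big_ord_recr /= coefXn eqxx scale1r.
by rewrite big1 ?add0r // => i _; rewrite coefXn ltn_eqF // scale0r.
Qed.

Lemma poly_op_polyE n (c : nat -> K) x :
  poly_op (\poly_(i < n) c i) T x = \sum_(i < n) c i *: iter i T x.
Proof.
rewrite (@poly_op_widen n) ?size_poly //; apply: eq_bigr => i _.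
by rewrite coef_poly ltn_ord.
Qed.

Lemma dep_iter_poly n x : ~ indep n (fun i => iter i T x) ->
  exists P, P != 0 /\ poly_op P T x = 0.
Proof.
move=> /indepPn[c [c0 [i ltin ci]]]; exists (\poly_(i < n) c i).
rewrite poly_op_polyE; split=> //; apply: contraNneq ci => /(congr1 (coefp i)).
by rewrite /= coef_poly ltin coef0 => ->.
Qed.

Lemma poly_dep_iter P x : P != 0 -> poly_op P T x = 0 ->
  ~ indep (size P) (fun i => iter i T x).
Proof.
move=> P0 Px /(_ (fun i => P`_i) Px (size P).-1).
rewrite ltn_predL lt0n size_poly_eq0 => /(_ P0)/eqP.
by rewrite -/(lead_coef P) lead_coef_eq0 (negPf P0).
Qed.

(** At the first dependence an iterate falls into the span of the earlier ones; that span is then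
    [T]-stable and contains the whole orbit. *)
Lemma iter_spanned n x : ~ indep n (fun i => iter i T x) ->
  forall k, spanned n (fun i => iter i T x) (iter k T x).
Proof.
move=> dn; pose b i := iter i T x.
have [m [lemn im dm]] : exists m, [/\ (m < n)%N, indep m b & ~ indep m.+1 b].
  elim: n dn => [|n IHn] dn; first by case: dn => c _ i.
  have [im|/IHn[m [ltmn im dm]]] := pselect (indep n b); first by exists n.
  by exists m; split=> //; apply: ltnW.
have mm : spanned m b (b m) by apply: contrapT => /(indepS im).
have sm k : spanned m b (b k).
  elim: k => [|k [c cE]].
    by case: m mm {lemn im dm} => // m _; apply: spanned_mem.
  rewrite /b iterS -/(b k) cE linear_sum; apply: spanned_sum => i _.
  rewrite linearZ /= -iterS -/(b i.+1); apply: spannedZ.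
  have := ltn_ord i; rewrite leq_eqVlt => /predU1P[->//|]; exact: spanned_mem.
move=> k; apply: spanned_trans (sm k) => i ltim.
by apply: (@spanned_mem _ _ _ b); apply: ltn_trans lemn.
Qed.

End PolyOp.

(** The points d/2, d/3, ... give [size q] distinct candidates, more than [q] has roots. *)
Lemma exists_nonroot (K : numFieldType) (q : {poly K}) (d : K) :
  q != 0 -> 0 < d -> exists t, [/\ 0 < t, t < d & q.[t] != 0].
Proof.
move=> q0 d0; pose s := [seq d / k.+2%:R | k <- iota 0 (size q)].
have sP t : t \in s -> 0 < t < d.
  move=> /mapP[k _ ->]; rewrite divr_gt0 //= ltr_pdivrMr //.
  by rewrite -[X in X < _]mulr1 ltr_pM2l // ltr1n.
have us : uniq s.
  rewrite map_inj_uniq ?iota_uniq // => i j /(mulfI (lt0r_neq0 d0))/invr_inj/eqP.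
  by rewrite eqr_nat => /eqP[].
have : ~~ all (root q) s.
  by apply/negP => /(max_poly_roots q0)/(_ us); rewrite size_map size_iota ltnn.
by move=> /allPn[t /sP/andP[t0 td] qt]; exists t.
Qed.

(* Kaplansky: if [p] is the minimal polynomial of a vector [x] of maximal local
   degree, perturbing [x] to [x + t w] shows that [p(T) w] lies in the cyclic
   subspace of [x], hence [p(T) (p(T) w) = 0]. *)
Lemma locally_algebraic_bounded (K : numFieldType) (A : lmodType K)
    (T : {linear A -> A}) (W : set A) (N : nat) :
  (forall t x y, W x -> W y -> W (x + t *: y)) ->
  (forall x, W x -> ~ indep N (fun i => iter i T x)) ->
  exists P : {poly K}, [/\ P != 0, annihilates_on W T P & ((size P).-1 <= N.*2)%N].
Proof.
move=> WD; elim: N => [|m IHm] dN.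
  exists 1; split; rewrite ?oner_neq0 ?size_poly1 // => x /dN[].
  by move=> c _ i.
(* If no vector has [m] independent iterates, induction applies; otherwise [m] is the maximal local
   degree. *)
have [ex|nex] := pselect (exists2 x, W x & indep m (fun i => iter i T x)); last first.
  have [|P [P0 PW sP]] := IHm; first by move=> x Wx ix; apply: nex; exists x.
  by exists P; split=> //; apply: leq_trans sP _; rewrite leq_double.
have {IHm} [x Wx ix] := ex.
have [a aE] : spanned m (fun i => iter i T x) (iter m T x).
  apply: contrapT => ns; apply: (dN x Wx); exact: indepS.
pose p : {poly K} := 'X^m - \poly_(i < m) a i.
have pE y : poly_op p T y = iter m T y - \sum_(i < m) a i *: iter i T y.
  by rewrite /p -[- \poly_(i < m) _]scaleN1r poly_opDl poly_opZl poly_op_XnE poly_op_polyE scaleN1r.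
have px : poly_op p T x = 0 by rewrite pE aE subrr.
have sp : size p = m.+1.
  by rewrite size_polyDl ?size_polyXn // size_polyN ltnS size_poly.
have p0 : p != 0 by rewrite -size_poly_eq0 sp.
have key w : W w -> spanned m (fun i => iter i T x) (poly_op p T w).
  move=> Ww; apply: contrapT => ns.
  (* This deforms the iterates of [x] followed by [p(T) w]. It is independent at [t = 0], since
     [p(T) w] is assumed outside their span, hence also at some [t > 0]. *)
  pose f i t := if (i < m)%N then iter i T x + t *: iter i T w else poly_op p T w.
  have f0 : indep m.+1 (fun i => f i 0).
    apply: indepS; first by apply: eq_indep ix => i im; rewrite /f im scale0r addr0.
    rewrite /f ltnn => -[c cE]; apply: ns; exists c; rewrite cE.
    by apply: eq_bigr => i _; rewrite ltn_ord scale0r addr0.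
  have [|q [q0 qf]] := indep_polyfun _ f0.
    move=> i; rewrite /f; case: ltnP => _; last exact: polyfun_cst.
    apply: polyfunD; first exact: polyfun_cst.
    by apply: eq_polyfun (polyfun_mon 1 _) => t; rewrite expr1.
  have [|t [t0 _ /qf it]] := exists_nonroot (q := q) _ ltr01.
    by apply: contraNneq q0 => ->; rewrite horner0.
  apply: (dN (x + t *: w)); first exact: WD.
  move=> c c0; have xtw i : iter i T (x + t *: w) = iter i T x + t *: iter i T w.
    by rewrite addrC iter_linear addrC.
  (* Since [p(T) x = 0], the last iterate of [x + t *: w] is [t *: p(T) w] modulo the lower ones, so
     a relation between the iterates becomes one within [f]. *)
  have mE : iter m T (x + t *: w) =
      t *: poly_op p T w + \sum_(i < m) a i *: iter i T (x + t *: w).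
    have -> : t *: poly_op p T w = poly_op p T (x + t *: w).
      by rewrite addrC poly_op_linear px addr0.
    by rewrite pE subrK.
  pose c' i := if (i < m)%N then c i + c m * a i else c m * t.
  have c'0 : \sum_(i < m.+1) c' i *: f i t = 0.
    rewrite -[RHS]c0 !big_ord_recr /= mE /c' /f ltnn scalerDr scalerA.
    rewrite [c m * t *: _ + _]addrC addrA; congr (_ + _).
    rewrite scaler_sumr -big_split /=; apply: eq_bigr => i _.
    by rewrite ltn_ord scalerDl scalerA xtw.
  have c'i := it c' c'0.
  have cm : c m = 0.
    have := c'i m (ltnSn m); rewrite /c' ltnn => /eqP.
    by rewrite mulf_eq0 (gt_eqF t0) orbF => /eqP.
  move=> i; rewrite ltnS leq_eqVlt => /predU1P[->//|im].
  by have := c'i i (ltnW im); rewrite /c' im cm mul0r addr0.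
exists (p * p); split.
- by rewrite mulf_neq0.
- move=> w /key[c cE]; rewrite poly_opM cE poly_op_sumr big1 // => i _.
  have iter0 k : iter k T 0 = 0 by elim: k => //= k ->; rewrite linear0.
  by rewrite poly_op_iter px iter0 scaler0.
- by rewrite size_mul // sp addSn addnS /= doubleS -addnn !leqW.
Qed.

(** * Dimension through spanning and independent families *)

Section Dimension.
Context {K : fieldType} {A : lmodType K}.

Lemma has_dim_basis (W : set A) n : has_dim W n -> exists b : nat -> A,
  [/\ forall i, (i < n)%N -> W (b i), indep n b & forall x, W x -> spanned n b x].
Proof.
move=> [b [bW ib sb]].
pose b' i := if insub i is Some i' then b i' else 0.
have b'E (i : 'I_n) : b' i = b i by rewrite /b' valK.
exists b'; split.
- by move=> i ltin; have := bW (Ordinal ltin); rewrite -b'E.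
- move=> c c0 i ltin; apply: (ib (fun i => c i) _ (Ordinal ltin)).
  by rewrite -[RHS]c0; apply: eq_bigr => j _; rewrite b'E.
- move=> x /sb[c ->]; exists (fun i => if insub i is Some i' then c i' else 0).
  by apply: eq_bigr => j _; rewrite b'E valK.
Qed.

Lemma has_dim_le (W : set A) m n b :
  (forall x, W x -> spanned m b x) -> has_dim W n -> (n <= m)%N.
Proof.
move=> sW /has_dim_basis[b' [b'W ib' _]]; apply: steinitz ib' _ => i /b'W.
exact: sW.
Qed.

(** By [steinitz], independent families in [W] have at most [m] members; one of maximal length is a
    basis. *)
Lemma has_dim_exists (W : set A) m b :
  (forall x, W x -> spanned m b x) -> exists n, has_dim W n.
Proof.
move=> sW.
pose Q n := `[< exists2 b', (forall i, (i < n)%N -> W (b' i)) & indep n b' >].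
have Q0 : exists n, Q n by exists 0%N; apply/asboolP; exists (fun=> 0).
have Qle n : Q n -> (n <= m)%N.
  by move=> /asboolP[b' b'W ib']; apply: steinitz ib' _ => i /b'W; exact: sW.
case: (ex_maxnP Q0 Qle) => n /asboolP[b' b'W ib'] maxn.
exists n, (fun i => b' i); split.
- by move=> i; apply: b'W.
- move=> c c0 i.
  have := ib' (fun i => if insub i is Some i' then c i' else 0) _ i (ltn_ord i).
  rewrite valK; apply; rewrite -[RHS]c0; apply: eq_bigr => j _; by rewrite valK.
- move=> x Wx; suff [c ->] : spanned n b' x by exists (fun i => c i).
  apply: contrapT => ns.
  suff /maxn : Q n.+1 by rewrite ltnn.
  apply/asboolP; exists (fun i => if (i < n)%N then b' i else x).
    by move=> i; case: ifP => // ltin _; apply: b'W.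
  apply: indepS; first by apply: eq_indep ib' => i ->.
  rewrite ltnn => -[c cE]; apply: ns; exists c; rewrite cE.
  by apply: eq_bigr => i _; rewrite ltn_ord.
Qed.

End Dimension.

(** * Archimedean property and completeness of the scalars *)

Section Completeness.

(** Stated for normed groups, so as to cover both the scalar field and the algebra. *)
Definition seq_complete (K : numFieldType) (V : normedZmodType K) : Prop :=
  forall u : nat -> V,
    (forall eps : K, 0 < eps -> exists N, forall m n,
      (N <= m)%N -> (N <= n)%N -> `|u m - u n| < eps) ->
  exists l : V, forall eps : K, 0 < eps -> exists N, forall n,
    (N <= n)%N -> `|l - u n| < eps.

(** The Archimedean property; positive elements of a [numFieldType] are real, so it makes sense over
    the complex numbers too. *)
Definition invS_cvg0 (K : numFieldType) : Prop :=
  forall eps : K, 0 < eps -> exists n, n.+1%:R^-1 < eps.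

Lemma seq_complete_completeNormedMod (K : numFieldType)
  (V : completeNormedModType K) : seq_complete V.
Proof.
move=> u cu; have /cauchy_cvgP : cauchy (u @ \oo)%classic.
  apply/cauchy_exP => e e0; have [N uN] := cu e e0.
  exists (u N), N => // n /= Nn; rewrite -ball_normE /=; exact: uN.
rewrite cvg_ex => -[l /cvgrPdist_lt ul]; exists l => e /ul [N _ uN].
by exists N.
Qed.

Lemma invS_cvg0_real (R : realType) : invS_cvg0 R.
Proof.
move=> e e0; exists (Num.truncn e^-1).
by rewrite -ltf_pV2 ?posrE ?invr_gt0 ?ltr0n // invrK truncnS_gt.
Qed.

Lemma seq_complete_real (R : realType) : seq_complete R.
Proof. exact: (@seq_complete_completeNormedMod R R). Qed.

Local Open Scope complex_scope.

Lemma invS_cvg0_complex (R : realType) : invS_cvg0 R[i].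
Proof.
move=> e e0; have eE : e = (complex.Re e)%:C by rewrite RRe_real // gtr0_real.
have /invS_cvg0_real[n ltn] : 0 < complex.Re e by rewrite -ltcR -eE.
exists n; rewrite eE; apply: le_lt_trans (_ : (n.+1%:R^-1)%:C < _).
  by rewrite fmorphV rmorph_nat.
by rewrite ltcR.
Qed.

Lemma norm_complex_i (R : rcfType) : `|'i%C : R[i]| = 1.
Proof.
by rewrite normc_def /= expr0n expr1n /= add0r sqrtr1.
Qed.

Lemma norm_Im_le (R : rcfType) (z : R[i]) : `|complex.Im z|%:C <= `|z|.
Proof.
have -> : complex.Im z = complex.Re (z * - 'i).
  by rewrite mulrN raddfN /= ReiNIm opprK.
apply: le_trans (normc_ge_Re _) _; by rewrite normrM normrN norm_complex_i mulr1.
Qed.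

Lemma seq_complete_complex (R : realType) : seq_complete R[i].
Proof.
move=> u cu.
have part (f : {additive R[i] -> R}) : (forall z, `|f z|%:C <= `|z|) ->
    exists l : R, forall eps : R, 0 < eps -> exists N, forall n,
      (N <= n)%N -> `|l - f (u n)| < eps.
  move=> fle; apply: seq_complete_real => e e0.
  have /cu[N uN] : 0 < e%:C by rewrite ltcR.
  exists N => m n Nm Nn; rewrite -raddfB -ltcR.
  exact: le_lt_trans (fle _) (uN _ _ Nm Nn).
have [a ua] := part (@complex.Re R) (@normc_ge_Re R).
have [b ub] := part (@complex.Im R) (@norm_Im_le R).
exists (a +i* b) => e e0.
have eE : e = (complex.Re e)%:C by rewrite RRe_real // gtr0_real.
have e20 : 0 < complex.Re e / 2 by rewrite divr_gt0 // -ltcR -eE.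
have [N uN] := ua _ e20; have [N' uN'] := ub _ e20.
exists (maxn N N') => n; rewrite geq_max => /andP[/uN un /uN' un'].
rewrite [X in `|X|]complexE; apply: le_lt_trans (ler_normD _ _) _.
have nC (x : R) : `|x%:C| = `|x|%:C.
  by rewrite normc_def /= expr0n addr0 sqrtr_sqr.
rewrite normrM !nC norm_complex_i mul1r.
rewrite -rmorphD /= eE ltcR [X in _ < X]splitr.
by case: (u n) un un' => x y /= un un'; apply: ltrD.
Qed.

End Completeness.

(** * Openness of linear independence in a normed space *)

Section OpenIndependence.
Context {K : numFieldType} (invS0 : invS_cvg0 K) (cK : seq_complete K).

(** The order of [K] may be partial, but positive elements are real and hence comparable. *)
Lemma exists_pos_le (a b : K) : 0 < a -> 0 < b ->
  exists c, [/\ 0 < c, c <= a & c <= b].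
Proof.
move=> a0 b0; case: (real_leP (gtr0_real a0) (gtr0_real b0)) => [ab|/ltW ba].
  by exists a.
by exists b.
Qed.

Context {A : normedModType K}.
Implicit Types b : nat -> A.

(** Finite-dimensional subspaces are closed: if combinations approached [b n], their coefficients
    would be Cauchy by the lower bound and their limits would express [b n]. *)
Lemma indep_dist n b : indep n.+1 b ->
  (exists2 d : K, 0 < d & forall c : nat -> K,
     d * \sum_(i < n) `|c i| <= `|\sum_(i < n) c i *: b i|) ->
  exists2 d : K, 0 < d & forall c : nat -> K, d <= `|b n - \sum_(i < n) c i *: b i|.
Proof.
move=> ib [d d0 dle]; apply: contrapT => nodist.
have /choice[c cE] : forall k, exists c : nat -> K,
    `|b n - \sum_(i < n) c i *: b i| < k.+1%:R^-1.
  move=> k; apply: contrapT => nc; apply: nodist; exists k.+1%:R^-1.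
    by rewrite invr_gt0.
  move=> c; rewrite real_leNgt ?normr_real ?realV ?realn //.
  by apply/negP => ?; apply: nc; exists c.
have cB k l i : (i < n)%N -> d * `|c k i - c l i| < k.+1%:R^-1 + l.+1%:R^-1.
  move=> ltin.
  apply: le_lt_trans (_ : _ <= `|\sum_(i < n) (c k i - c l i) *: b i|) _.
    apply: le_trans (dle (fun i => c k i - c l i)).
    rewrite ler_pM2l // (bigD1 (Ordinal ltin)) //= lerDl.
    by apply: sumr_ge0.
  have -> : \sum_(i < n) (c k i - c l i) *: b i =
     (b n - \sum_(i < n) c l i *: b i) - (b n - \sum_(i < n) c k i *: b i).
    rewrite opprB addrC addrA subrK -sumrB.
    by apply: eq_bigr => j _; rewrite scalerBl.
  by apply: le_lt_trans (ler_normB _ _) _; rewrite addrC ltrD.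
have invS_le N k : (N <= k)%N -> k.+1%:R^-1 <= N.+1%:R^-1 :> K.
  by move=> Nk; rewrite lef_pV2 ?posrE ?ltr0n // ler_nat.
have /choice[l lE] : forall i, exists l : K, (i < n)%N ->
    forall eps : K, 0 < eps -> exists N, forall k, (N <= k)%N -> `|l - c k i| < eps.
  move=> i; have [ltin|] := ltnP i n; last by exists 0.
  have [|l lE] := cK (u := fun k => c k i).
    move=> e e0; have [|N NE] := invS0 (eps := d * e / 2).
      by rewrite divr_gt0 ?mulr_gt0.
    exists N => p q Np Nq; rewrite -(ltr_pM2l d0).
    apply: lt_trans (cB _ _ _ ltin) _; rewrite [X in _ < X]splitr.
    by rewrite ltrD // (le_lt_trans _ NE) // invS_le.
  by exists l.
suff bn : b n = \sum_(i < n) l i *: b i.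
  have := ib (fun i => if (i < n)%N then l i else -1) _ n (ltnSn n).
  rewrite ltnn => /(_ _)/eqP; rewrite oppr_eq0 oner_eq0 => /(_ _)/notF; apply.
  rewrite big_ord_recr /= ltnn scaleN1r bn; apply/eqP; rewrite subr_eq0.
  by apply/eqP; apply: eq_bigr => i _; rewrite ltn_ord.
apply/eqP; rewrite -subr_eq0 -normr_le0 real_leNgt ?normr_real ?real0 //.
apply/negP => e0; set e := `|_| in e0.
pose S := \sum_(i < n) `|b i|.
have S0 : 0 <= S by apply: sumr_ge0.
(* Coefficients this close to their limits change the combination by at most [e / 2]; the [1 +]
   avoids a zero denominator. *)
have e'0 : 0 < e / 2 / (1 + S) by rewrite !divr_gt0 // ltr_pwDl.
have [k [k1 k2]] : exists k, k.+1%:R^-1 < e / 2 /\ forall i, (i < n)%N ->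
    `|l i - c k i| < e / 2 / (1 + S).
  have /choice[NN NNE] : forall i, exists N, forall k, (i < n)%N -> (N <= k)%N ->
      `|l i - c k i| < e / 2 / (1 + S).
    move=> i; have [/lE/(_ _ e'0)[N NE]|] := ltnP i n; last by exists 0%N.
    by exists N => k _; apply: NE.
  have [|N NE] := invS0 (eps := e / 2); first by rewrite divr_gt0.
  exists (maxn N (\max_(i < n) NN i)); split.
    by apply: le_lt_trans NE; rewrite invS_le // leq_maxl.
  move=> i ltin; apply: NNE => //; rewrite leq_max.
  by rewrite (leq_bigmax (Ordinal ltin)) orbT.
suff : e < e by rewrite ltxx.
have eE : b n - \sum_(i < n) l i *: b i = (b n - \sum_(i < n) c k i *: b i)
    + \sum_(i < n) (c k i - l i) *: b i.
  rewrite -addrA; congr (_ + _); rewrite -!sumrN -big_split.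
  by apply: eq_bigr => i _ /=; rewrite scalerBl addKr.
rewrite {1}/e eE; apply: le_lt_trans (ler_normD _ _) _.
rewrite [X in _ < X]splitr; apply: ltr_leD.
  exact: lt_trans (cE k) k1.
apply: le_trans (ler_norm_sum _ _ _) _.
apply: le_trans (_ : \sum_(i < n) e / 2 / (1 + S) * `|b i| <= _).
  apply: ler_sum => i _; rewrite normrZ distrC ler_wpM2r // ltW //.
  exact: k2.
rewrite -mulr_sumr -/S -mulrA ler_piMr ?divr_ge0 ?ltW //.
by rewrite mulrC ltr_pdivrMr ?mul1r ?ltrDr // ltr_pwDl.
Qed.

(** By induction: the distance from [b n] to the span of its predecessors bounds the last
    coefficient, and subtracting that term leaves a shorter combination. *)
Lemma indep_norm_lb n b : indep n b ->
  exists2 d : K, 0 < d & forall c : nat -> K,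
    d * \sum_(i < n) `|c i| <= `|\sum_(i < n) c i *: b i|.
Proof.
elim: n => [|n IHn] ib.
  by exists 1 => // c; rewrite !big_ord0 mulr0.
have lb := IHn (indep_le (leqnSn n) ib).
have [h h0 hle] := indep_dist ib lb; have [d d0 dle] := lb.
pose M := h^-1 + (1 + `|b n| / h) / d.
have M0 : 0 < M by rewrite addr_gt0 ?divr_gt0 ?invr_gt0 // ltr_pwDl // divr_ge0 // ltW.
exists M^-1; first by rewrite invr_gt0.
move=> c; rewrite ler_pdivrMl // !big_ord_recr /=.
set s := \sum_(i < n) c i *: b i; set y := s + _.
have cn : `|c n| <= h^-1 * `|y|.
  rewrite ler_pdivlMl //; have [->|cn] := eqVneq (c n) 0.
    by rewrite normr0 mulr0.
  have -> : y = c n *: (b n - \sum_(i < n) (- (c n)^-1 * c i) *: b i).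
    rewrite scalerBr /y addrC; congr (_ + _); rewrite scaler_sumr -sumrN.
    by apply: eq_bigr => i _; rewrite scalerA mulrA mulrN mulfV // mulN1r scaleNr opprK.
  by rewrite normrZ mulrC ler_wpM2l // (hle (fun i => - (c n)^-1 * c i)).
have sn : \sum_(i < n) `|c i| <= (1 + `|b n| / h) / d * `|y|.
  rewrite mulrAC ler_pdivlMr // mulrC; apply: le_trans (dle c) _; rewrite -/s.
  have -> : s = y - c n *: b n by rewrite /y addrK.
  apply: le_trans (ler_normB _ _) _; rewrite mulrDl mul1r lerD2l normrZ.
  by rewrite mulrC -mulrA ler_wpM2l.
by rewrite addrC /M mulrDl lerD.
Qed.

(** If each vector moves by less than half the constant of [indep_norm_lb], a relation for [b']
    makes the sum of coefficient norms at most half of itself. *)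
Lemma indep_near n b : indep n b -> exists2 d : K, 0 < d &
  forall b', (forall i, (i < n)%N -> `|b i - b' i| < d) -> indep n b'.
Proof.
move=> /indep_norm_lb[d d0 dle]; exists (d / 2); first by rewrite divr_gt0.
move=> b' bb' c c0.
have : \sum_(i < n) `|c i| <= 0.
  have d20 : 0 < d / 2 by rewrite divr_gt0.
  rewrite -(ler_pM2l d20) mulr0.
  suff : d * \sum_(i < n) `|c i| <= d / 2 * \sum_(i < n) `|c i|.
    by rewrite {1}(splitr d) mulrDl gerDl.
  apply: le_trans (dle c) _; 
  have -> : \sum_(i < n) c i *: b i = \sum_(i < n) (c i *: b i - c i *: b' i).
    by rewrite sumrB c0 subr0.
  apply: le_trans (ler_norm_sum _ _ _) _; rewrite mulr_sumr.
  apply: ler_sum => i _; rewrite -scalerBr normrZ mulrC ler_wpM2r //.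
  by rewrite ltW // bb'.
move=> le0 i ltin; apply/eqP; rewrite -normr_le0; apply: le_trans le0.
by rewrite (bigD1 (Ordinal ltin)) //= lerDl sumr_ge0.
Qed.

End OpenIndependence.

(* [sequences.Baire] is only available over [realType], which excludes
   complex scalars. *)
Lemma baire_numField (K : numFieldType) (A : normedZmodType K)
    (F : nat -> A -> Prop) : invS_cvg0 K -> seq_complete A ->
  (forall n x, F n x -> exists2 d : K, 0 < d & forall y, `|x - y| < d -> F n y) ->
  (forall n x (r : K), 0 < r -> exists2 y, `|x - y| < r & F n y) ->
  exists x, forall n, F n x.
Proof.
move=> invS0 cA oF dF.
(* One step of the nested-ball construction: inside a given closed ball, a smaller one contained in
   [F n] and of radius at most [1/(n+1)]. *)
have step : forall nxr : nat * {xr : A * K | 0 < xr.2},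
    exists ys : {xr : A * K | 0 < xr.2},
    [/\ (sval ys).2 <= nxr.1.+1%:R^-1,
        (forall z, `|(sval ys).1 - z| <= (sval ys).2 ->
                   `|(sval nxr.2).1 - z| <= (sval nxr.2).2) &
        forall z, `|(sval ys).1 - z| <= (sval ys).2 -> F nxr.1 z].
  move=> [n [[x r] /= r0]]; have [y xy /oF[d d0 Fy]] := dF n x r r0.
  have xyr : 0 < r - `|x - y| by rewrite subr_gt0.
  have n0 : 0 < n.+1%:R^-1 :> K by rewrite invr_gt0.
  have [c [c0 cd cn]] := exists_pos_le d0 n0.
  have c20 : 0 < c / 2 by rewrite divr_gt0.
  have [c' [c'0 c'c c'r]] := exists_pos_le c20 xyr.
  have c2c : c / 2 < c by rewrite {2}(splitr c) ltrDl.
  exists (exist _ (y, c') c'0) => /=; split.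
  - exact: le_trans c'c (le_trans (ltW c2c) cn).
  - move=> z yz; rewrite -(subrKA y) (le_trans (ler_normD _ _)) //.
    by rewrite -lerBrDl (le_trans yz).
  - move=> z yz; apply: Fy; apply: le_lt_trans yz _.
    by apply: le_lt_trans c'c _; apply: lt_le_trans c2c _.
have [f fP] := choice step.
pose g := fix g n := if n is m.+1 then f (m, g m) else exist _ (0, 1) ltr01.
pose x n := (sval (g n)).1; pose r n := (sval (g n)).2.
have nested m n z : (m <= n)%N -> `|x n - z| <= r n -> `|x m - z| <= r m.
  move=> /subnKC <-; elim: (n - m)%N => [|k IHk]; first by rewrite addn0.
  by rewrite addnS => xz; apply: IHk; have [_ + _] := fP (m + k, g (m + k))%N; apply.
have r_ge0 n : 0 <= r n by apply: ltW; apply: (svalP (g n)).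
have xx m n : (m <= n)%N -> `|x m - x n| <= r m.
  by move=> mn; apply: nested mn _; rewrite subrr normr0.
have [|l xl] := cA x.
  move=> e e0; have [|N NE] := invS0 (e / 2); first by rewrite divr_gt0.
  have rN : r N.+1 < e / 2 by have [+ _ _] := fP (N, g N); move/le_lt_trans; apply.
  exists N.+1 => m n Nm Nn; rewrite -(subrKA (x N.+1)) [X in _ < X]splitr.
  apply: le_lt_trans (ler_normD _ _) _; rewrite distrC.
  by apply: ltrD; apply: le_lt_trans rN; exact: xx.
exists l => n; have [_ _] := fP (n, g n); apply; rewrite -/(g n.+1) -/(x n.+1).
(* If [l] lay outside this closed ball, so would late terms of the sequence, against [xx]. *)
rewrite -/(r n.+1) real_leNgt ?normr_real ?ger0_real //; apply/negP => lt.
have [|N xN] := xl (`|x n.+1 - l| - r n.+1); first by rewrite subr_gt0.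
have := xN (maxn N n.+1) (leq_maxl _ _).
apply/negP; rewrite -real_leNgt ?realB ?normr_real ?ger0_real //.
rewrite lerBlDr; apply: le_trans (ler_distD (x (maxn N n.+1)) _ _) _.
rewrite addrC distrC lerD2l.
by apply: xx; rewrite leq_maxr.
Qed.

(** * Identities between the Peirce components *)

Section PeirceIdentities.
Context {K : numFieldType} {A : lmodType K}.
Context (mul : {bilinear A -> A -> A}) (omega : {scalar A}) (e : A).
Context (bern : is_bernstein mul omega) (e_neq0 : e != 0) (ee : mul e e = e).

Local Notation "x ** y" := (mul x y) (at level 40, left associativity).
Local Notation U := (peirceU mul e).
Local Notation V := (peirceV mul e).

Let mulC x y : x ** y = y ** x. Proof. exact: bernstein_mulC bern x y. Qed.
Let mulDl x y z : (x + y) ** z = x ** z + y ** z. Proof. exact: linearDl. Qed.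
Let mulDr x y z : x ** (y + z) = x ** y + x ** z. Proof. exact: linearD. Qed.
Let mulNr x y : x ** (- y) = - (x ** y). Proof. exact: linearN. Qed.
Let mulNl x y : (- x) ** y = - (x ** y). Proof. by rewrite mulC mulNr mulC. Qed.
Let mul0r x : x ** 0 = 0. Proof. exact: linear0. Qed.
Let mulZr k x y : x ** (k *: y) = k *: (x ** y). Proof. exact: linearZ. Qed.
Let mulZl k x y : (k *: x) ** y = k *: (x ** y).
Proof. by rewrite mulC mulZr mulC. Qed.
Let mulMnr n x y : x ** (y *+ n) = x ** y *+ n. Proof. exact: linearMn. Qed.
Let mulMnl n x y : (x *+ n) ** y = x ** y *+ n.
Proof. by rewrite mulC mulMnr mulC. Qed.

Lemma double_eq0 (x : A) : x *+ 2 = 0 -> x = 0.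
Proof.
by move/eqP; rewrite -scaler_nat scaler_eq0 pnatr_eq0 => /eqP.
Qed.

(** Applied to an identity and its image under a sign change, this makes the even and odd parts
    vanish separately. *)
Lemma addr_subr_eq0 (x y : A) : x + y = 0 -> x - y = 0 -> x = 0 /\ y = 0.
Proof.
move=> /eqP; rewrite addr_eq0 => /eqP ->; rewrite -opprD -mulr2n => /eqP.
by rewrite oppr_eq0 => /eqP/double_eq0 ->; rewrite oppr0.
Qed.

Lemma mul_sqrD x y : (x + y) ** (x + y) = x ** x + x ** y *+ 2 + y ** y.
Proof. by rewrite mulDl !mulDr (mulC y x) mulr2n !addrA. Qed.

Lemma mul_sqr_polar (x y : A) (f : A -> A) :
  (forall a b, f (a + b) = f a + f b) ->
  f (x ** x) = 0 -> f (y ** y) = 0 -> f ((x + y) ** (x + y)) = 0 ->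
  f (x ** y) = 0.
Proof.
move=> fD fx fy; rewrite mul_sqrD !fD fx fy add0r addr0 -mulr2n.
exact: double_eq0.
Qed.

Lemma peirceU_double u : U u -> e ** u *+ 2 = u.
Proof. by move=> uU; rewrite -scaler_nat. Qed.

Lemma peirceUD x y : U x -> U y -> U (x + y).
Proof. by move=> xU yU; rewrite /peirceU /= mulDr scalerDr xU yU. Qed.

Lemma peirceUZ k x : U x -> U (k *: x).
Proof. by move=> xU; rewrite /peirceU /= mulZr scalerA mulrC -scalerA xU. Qed.

Lemma peirceVD x y : V x -> V y -> V (x + y).
Proof. by move=> xV yV; rewrite /peirceV /= mulDr xV yV addr0. Qed.

Lemma peirceVZ k x : V x -> V (k *: x).
Proof. by move=> xV; rewrite /peirceV /= mulZr xV scaler0. Qed.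

Lemma peirceUN x : U x -> U (- x).
Proof. by rewrite -scaleN1r; exact: peirceUZ. Qed.

Lemma peirceVN x : V x -> V (- x).
Proof. by rewrite -scaleN1r; exact: peirceVZ. Qed.

Let weightU u : U u -> omega u = 0. Proof. exact: weight_peirceU. Qed.
Let weightV v : V v -> omega v = 0. Proof. exact: weight_peirceV. Qed.

Lemma weight0_sqr_sqr b : omega b = 0 -> (b ** b) ** (b ** b) = 0.
Proof.
by move=> wb; rewrite (bernstein_identity bern) wb expr0n scale0r.
Qed.

(** The element [e + b] has weight 1, so the Bernstein identity makes its square [d] idempotent. *)
Let bernE b : omega b = 0 -> let d := e + e ** b *+ 2 + b ** b in d ** d = d.
Proof.
move=> wb /=; have := bernstein_identity bern (e + b).
by rewrite mul_sqrD ee [omega _]linearD /= wb (weight_idempotent bern) // addr0 expr1n scale1r.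
Qed.

Let sqr_eU u : U u -> (e + u) ** (e + u) = e + u + u ** u.
Proof. by move=> uU; rewrite mul_sqrD ee peirceU_double. Qed.

(** Idempotency of [e + u + u^2] leaves [e u^2 + u u^2 = 0], whose two terms have opposite parity in
    [u]. *)
Lemma peirceU_sqr u : U u -> V (u ** u) /\ u ** (u ** u) = 0.
Proof.
have H w : U w -> e ** (w ** w) + w ** (w ** w) = 0.
  move=> wU; have := bernE (weightU wU); rewrite /= peirceU_double //.
  rewrite mul_sqrD sqr_eU // weight0_sqr_sqr ?weightU // addr0.
  by rewrite -[RHS]addr0 => /addrI/double_eq0; rewrite mulDl.
move=> uU; have := H _ uU; have := H _ (peirceUN uU).
by rewrite !(mulNl, mulNr, opprK) => h1 h2; have [] := addr_subr_eq0 h2 h1.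
Qed.

Lemma peirceV_sqr v : V v -> U (v ** v).
Proof.
move=> vV; have := bernE (weightV vV); rewrite /= vV mul0rn addr0 mul_sqrD ee.
rewrite weight0_sqr_sqr ?weightV // addr0 => /addrI.
by rewrite -scaler_nat.
Qed.

Lemma peirceUU u w : U u -> U w -> V (u ** w).
Proof.
move=> uU wU; apply: (@mul_sqr_polar u w (mul e)) => //.
- by have [] := peirceU_sqr uU.
- by have [] := peirceU_sqr wU.
- by have [] := peirceU_sqr (peirceUD uU wU).
Qed.

Lemma peirceVV v w : V v -> V w -> U (v ** w).
Proof.
move=> vV wV; apply/eqP; rewrite -subr_eq0; apply/eqP.
apply: (@mul_sqr_polar v w (fun x => 2%:R *: (e ** x) - x)).
- by move=> a b; rewrite mulDr scalerDr opprD addrACA.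
- by rewrite (peirceV_sqr vV) subrr.
- by rewrite (peirceV_sqr wV) subrr.
- by rewrite (peirceV_sqr (peirceVD vV wV)) subrr.
Qed.

Lemma peirceVU v u : V v -> U u -> U (v ** u).
Proof. by move=> vV uU; exact: (peirce_mulVU bern e_neq0 ee). Qed.

(** For [b = u + v] the idempotent of [bernE] is [e + X + Y] with [X] in [U] and [Y = u^2] in [V];
    its components give [X Y = 0] and [X^2 = Y]. The first bracket is even in [v], the second
    odd. *)
Let peirceUV_sqr u v : U u -> V v ->
  let m := v ** u *+ 2 in let s := v ** v in
  (u ** s *+ 2 + m ** m) + (u ** m *+ 2 + m ** s *+ 2) = 0.
Proof.
move=> uU vV m s.
have mU : U m by rewrite /m -scaler_nat; apply/peirceUZ/peirceVU.
have sU : U s by exact: peirceV_sqr.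
pose X := u + (m + s); pose Y := u ** u.
have XU : U X by do 2?apply: peirceUD.
have YV : V Y by have [] := peirceU_sqr uU.
have YY : Y ** Y = 0 by apply: weight0_sqr_sqr; exact: weightU.
have wuv : omega (u + v) = 0 by rewrite linearD /= weightU // weightV // addr0.
have XY : X ** X + X ** Y *+ 2 = Y.
  have := bernE wuv; rewrite /= [e ** _]mulDr vV addr0 peirceU_double //.
  rewrite [(u + v) ** _]mul_sqrD (mulC u v).
  rewrite -/m -/s -/Y.
  have -> : e + u + (Y + m + s) = (e + X) + Y.
    by rewrite -[Y + m + s]addrA [Y + _]addrC /X !addrA.
  rewrite mul_sqrD sqr_eU // YY addr0 [(e + X) ** Y]mulDl YV add0r -addrA => /addrI.
  by [].
(* Multiplication by [e] kills [X ** X] and [Y], both in [V], but only halves [X ** Y], which is in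
   [U]. *)
have XY0 : X ** Y = 0.
  have := congr1 (mul e) XY; rewrite mulDr mulMnr peirceU_double; last first.
    by rewrite mulC; exact: peirceVU.
  by rewrite (peirceUU XU XU) YV add0r.
have := XY; rewrite XY0 mul0rn addr0 /X mul_sqrD -/Y -addrA -[RHS]addr0 => /addrI.
rewrite mul_sqrD (weight0_sqr_sqr (weightV vV)) addr0 mulDr mulrnDl => h.
by rewrite addrACA [u ** s *+ 2 + _]addrC.
Qed.

(** A sign change of [v] separates the brackets of [peirceUV_sqr], then one of [u] separates [u v^2]
    from [(v u)^2]. In the odd bracket [(v u) v^2] vanishes by the first identity, applied to
    [v u]. *)
Let peirceUV_identities u v : U u -> V v ->
  [/\ u ** (v ** v) = 0, (v ** u) ** (v ** u) = 0 & u ** (v ** u) = 0].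
Proof.
have H w z : U w -> V z -> let m := z ** w *+ 2 in let s := z ** z in
    w ** s *+ 2 + m ** m = 0 /\ w ** m *+ 2 + m ** s *+ 2 = 0.
  move=> wU zV m s; apply: addr_subr_eq0; first exact: peirceUV_sqr.
  have := peirceUV_sqr wU (peirceVN zV).
  by rewrite /= !(mulNl, mulNr, mulNrn, opprK) -opprD.
have H1 w z : U w -> V z -> w ** (z ** z) = 0 /\ (z ** w) ** (z ** w) = 0.
  move=> wU zV; have [h _] := H w z wU zV; have [h' _] := H _ _ (peirceUN wU) zV.
  move: h'; rewrite !(mulNl, mulNr, mulNrn, opprK) addrC => h'.
  move: h; rewrite addrC => h; have [] := addr_subr_eq0 h h'.
  by rewrite mulMnl mulMnr => /double_eq0/double_eq0 -> /double_eq0.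
move=> uU vV; have [h1 h2] := H1 u v uU vV; split=> //.
have [_] := H u v uU vV; have [h3 _] := H1 _ _ (peirceVU vV uU) vV.
by rewrite !mulMnl h3 !mul0rn addr0 mulMnr => /double_eq0/double_eq0.
Qed.

Lemma peirceU_VV u v w : U u -> V v -> V w -> u ** (v ** w) = 0.
Proof.
move=> uU vV wV; apply: mul_sqr_polar (mulDr u) _ _ _.
- by have [] := peirceUV_identities uU vV.
- by have [] := peirceUV_identities uU wV.
- by have [] := peirceUV_identities uU (peirceVD vV wV).
Qed.

Lemma peirceVU_sqr u v : U u -> V v -> (v ** u) ** (v ** u) = 0.
Proof. by move=> uU vV; have [] := peirceUV_identities uU vV. Qed.

Lemma peirceU_VU u v : U u -> V v -> u ** (v ** u) = 0.
Proof. by move=> uU vV; have [] := peirceUV_identities uU vV. Qed.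

(** Linearizing [u (v u) = 0] in [u] lets [L_v] move across a product at the cost of a sign. *)
Lemma peirce_skew u w v : U u -> U w -> V v ->
  u ** (v ** w) = - ((v ** u) ** w).
Proof.
move=> uU wU vV; have := peirceU_VU (peirceUD uU wU) vV.
rewrite mulDl !mulDr (peirceU_VU uU vV) (peirceU_VU wU vV) add0r addr0.
by rewrite (mulC w) => /eqP; rewrite addr_eq0 => /eqP.
Qed.

Lemma peirceU_cube u : U u -> u ** (u ** u) = 0.
Proof. by move=> /peirceU_sqr[]. Qed.

(** This is the part of [(u + w)^3 = 0] linear in [w], isolated by a sign change of [w]. *)
Lemma peirceU_sqr_mul u w : U u -> U w -> (u ** u) ** w = - (u ** (u ** w)) *+ 2.
Proof.
move=> uU wU.
have H z : U z -> (u ** u) ** z + u ** (u ** z) *+ 2 +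
   ((z ** z) ** u + z ** (u ** z) *+ 2) = 0.
  move=> zU; have := peirceU_cube (peirceUD uU zU).
  rewrite mul_sqrD mulDl !mulDr !peirceU_cube // add0r addr0 -!mulr2n.
  rewrite (mulC z (u ** u)) (mulC u (z ** z)) => <-.
  by rewrite [u ** u ** z + _]addrC addrACA.
have h := H _ wU; have h' := H _ (peirceUN wU).
have : (u ** u) ** w + u ** (u ** w) *+ 2 = 0.
  move: h; rewrite addrC => h; have [] := addr_subr_eq0 h _ => //.
  by rewrite -[RHS]h' !(mulNl, mulNr, mulNrn, opprK) -opprD addrC.
by move/eqP; rewrite addr_eq0 mulNrn => /eqP.
Qed.

(* [L_e] has eigenvalues [1], [1/2] and [0], so the Peirce projections are
   quadratic polynomials in it. *)
Definition projU (a : A) : A := 4%:R *: (e ** a - e ** (e ** a)).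
Definition projV (a : A) : A := a - 3%:R *: (e ** a) + 2%:R *: (e ** (e ** a)).

Let idem_pair x r : (x + r) ** (x + r) = x + r ->
  (x - r) ** (x - r) = x - r -> x ** r *+ 2 = r.
Proof.
rewrite !mul_sqrD !(mulNl, mulNr, mulNrn, opprK) => h1 h2.
apply/eqP; rewrite -subr_eq0; apply/eqP.
suff [] : x ** x + r ** r - x = 0 /\ x ** r *+ 2 - r = 0 by [].
apply: addr_subr_eq0.
  move/eqP: h1; rewrite -subr_eq0 opprD => /eqP <-.
  by rewrite addrACA [x ** x + _ + _]addrAC.
move/eqP: h2; rewrite -subr_eq0 opprB => /eqP <-; rewrite opprB; move: (x ** r *+ 2) => p.
rewrite [x ** x - p + _]addrAC -[LHS]addrA -[RHS]addrA; congr (_ + _).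
by rewrite addrCA [RHS]addrCA [- x - p]addrC.
Qed.

Lemma peirce_decomposition a :
  exists u v, [/\ U u, V v & a = omega a *: e + u + v].
Proof.
pose b := a - omega a *: e.
have we : omega e = 1 by exact: weight_idempotent bern e_neq0 ee.
have wb : omega b = 0 by rewrite linearB linearZ /= we mulr1 subrr.
pose p := e ** b *+ 2.
(* Both [e + r + c^2] and [e - r + c^2] are idempotent, by [bernE] for [c] and [- c]; the part odd
   in [r] is kept. *)
have H c : omega c = 0 -> let r := e ** c *+ 2 in
    (e ** r + (c ** c) ** r) *+ 2 = r.
  move=> wc r; have h1 := bernE wc.
  have h2 : omega (- c) = 0 by rewrite linearN /= wc oppr0.
  have {h2} := bernE h2; move: h1; rewrite /= !(mulNl, mulNr, mulNrn, opprK) -/r.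
  rewrite ![e + _ + c ** c]addrAC -mulDl; exact: idem_pair.
(* [H] is used for [b] and for [2 b]: the term [b^2 p] is scaled by 8, but [e p] and [p] only by 2,
   so [b^2 p] vanishes. *)
have pU : U p.
  have h2 : omega (b *+ 2) = 0 by rewrite linearMn wb mul0rn.
  have := H _ h2; have := H b wb; rewrite /= [e ** (b *+ 2)]mulMnr -/p.
  clearbody p; rewrite !(mulMnr, mulMnl); set q := (b ** b) ** p => h1 /eqP {h2}.
  rewrite -subr_eq0 -mulrnBl => /eqP/double_eq0/eqP; rewrite subr_eq0 => /eqP h2.
  suff q0 : q = 0 by rewrite /peirceU /= scaler_nat -{2}h1 q0 addr0.
  have : q *+ 6 = 0; last first.
    by move/eqP; rewrite -scaler_nat scaler_eq0 pnatr_eq0 => /eqP.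
  have : (e ** p *+ 2 + q *+ 2 *+ 2 *+ 2) - (e ** p + q) *+ 2 = 0.
    by rewrite h2 h1 subrr.
  by rewrite [(_ + q) *+ 2]mulrnDl opprD addrACA subrr add0r -!mulrnA -mulrnBr.
exists p, (b - p); split=> //; last first.
  by rewrite -addrA [p + _]addrC subrK /b addrC subrK.
apply: double_eq0; rewrite mulDr mulNr mulrnBl.
by rewrite (peirceU_double pU) subrr.
Qed.

Lemma proj_peirce k u v : U u -> V v ->
  projU (k *: e + u + v) = u /\ projV (k *: e + u + v) = v.
Proof.
(* This [x] is a quarter of [u]; integer multiples of it avoid fractions. *)
move=> uU vV; pose x := e ** (e ** u).
have uE : e ** u = x *+ 2 by rewrite /x -mulMnr peirceU_double.
have u4 : u = x *+ 4 by rewrite -{1}(peirceU_double uU) uE -mulrnA.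
have eaE : e ** (k *: e + u + v) = k *: e + x *+ 2.
  by rewrite !mulDr vV addr0 mulZr ee uE.
have eeaE : e ** (e ** (k *: e + u + v)) = k *: e + x.
  by rewrite eaE mulDr mulZr ee -uE.
rewrite /projU /projV eeaE eaE; split.
  by rewrite opprD addrACA subrr add0r mulr2n addrK scaler_nat -u4.
have PQ : (k *: e + u) + 2%:R *: (k *: e + x) = 3%:R *: (k *: e + x *+ 2).
  rewrite !scaler_nat [(_ + x) *+ 2]mulrnDl [(_ + x *+ 2) *+ 3]mulrnDl -mulrnA u4.
  by rewrite addrACA -mulrS -mulrnDr.
by rewrite addrAC [_ + v + _]addrAC PQ addrAC subrr add0r.
Qed.

Lemma projU_peirce u v : U u -> V v -> projU (u + v) = u.
Proof.
by move=> uU vV; have := proj_peirce 0 uU vV; rewrite scale0r add0r => -[].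
Qed.

Lemma projV_peirce u v : U u -> V v -> projV (u + v) = v.
Proof.
by move=> uU vV; have := proj_peirce 0 uU vV; rewrite scale0r add0r => -[].
Qed.

Lemma projUP a : U (projU a).
Proof.
have [u [v [uU vV aE]]] := peirce_decomposition a.
by rewrite aE; have [-> _] := proj_peirce (omega a) uU vV.
Qed.

Lemma projVP a : V (projV a).
Proof.
have [u [v [uU vV aE]]] := peirce_decomposition a.
by rewrite aE; have [_ ->] := proj_peirce (omega a) uU vV.
Qed.

(** * Products along the orbits of [L_v], and local algebraicity *)

Lemma iter_peirceVU v u k : V v -> U u -> U (iter k (mul v) u).
Proof. by move=> vV uU; elim: k => //= k IHk; exact: peirceVU. Qed.

Lemma mul_iter_skew v u w k : V v -> U u -> U w ->
  u ** iter k (mul v) w = (-1) ^+ k *: (iter k (mul v) u ** w).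
Proof.
move=> vV uU wU; elim: k w wU => [|k IHk] w wU; first by rewrite expr0 scale1r.
rewrite [iter _ _ w]iterSr (IHk _ (peirceVU vV wU)).
rewrite (peirce_skew (iter_peirceVU k vV uU) wU vV) iterS.
by rewrite scalerN exprS mulN1r scaleNr.
Qed.

Lemma mul_iter_VV v u x y k : V v -> U u -> V x -> V y ->
  u ** iter k (mul v) (x ** y) = 0.
Proof.
move=> vV uU xV yV; rewrite (mul_iter_skew _ vV uU (peirceVV xV yV)).
by rewrite (peirceU_VV (iter_peirceVU k vV uU) xV yV) scaler0.
Qed.

(** Sharing the exponent evenly between the factors by [mul_iter_skew] leaves, up to sign, [w (v w)]
    or [(v w)^2] for an iterate [w] of [u]; both vanish. *)
Lemma mul_iter_self v u k : V v -> U u -> u ** iter k.+1 (mul v) u = 0.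
Proof.
move=> vV uU; have Ti i := iter_peirceVU i vV uU.
have split i j w : U w -> u ** iter (i + j) (mul v) w =
    (-1) ^+ i *: (iter i (mul v) u ** iter j (mul v) w).
  by move=> wU; rewrite iterD (mul_iter_skew _ vV uU (iter_peirceVU j vV wU)).
have [h [->|->]] : exists h, k.+1 = (h + h.+1)%N \/ k.+1 = (h.+1 + h.+1)%N.
- exists k./2; rewrite !addnS addSn addnn -{1 3}(odd_double_half k).
  by case: odd; [right | left].
- by rewrite split // iterS (peirceU_VU (Ti h)) ?scaler0.
- by rewrite split // iterS (peirceVU_sqr (Ti h)) ?scaler0.
Qed.

Lemma sqr_mul_iter v u k : V v -> U u -> (u ** u) ** iter k (mul v) u = 0.
Proof.
move=> vV uU; rewrite (peirceU_sqr_mul uU (iter_peirceVU k vV uU)).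
case: k => [|k]; last by rewrite mul_iter_self // mul0r oppr0 mul0rn.
by rewrite peirceU_cube // oppr0 mul0rn.
Qed.

(** By [dep_iter_poly] and [poly_dep_iter], this says that a nonzero polynomial in [L_a] kills [b].
    The length [n] is what is later made uniform. *)
Definition locally_algebraic_on (a b : A) : Prop :=
  exists n, ~ indep n (fun i => iter i (mul a) b).

(** For [u] in [U] and [v] in [V] this is the principal cube of [u + v]. *)
Let cube v u := v ** (u ** u) + (v ** (v ** u)) *+ 2 + v ** (v ** v).

Let mul_cube_terms a x y z :
  a ** (x + y *+ 2 + z) = a ** x + a ** y *+ 2 + a ** z.
Proof. by rewrite mulDr mulDr -mulMnr. Qed.

Let iter_cubeE v u k : iter k (mul v) (cube v u) =
  iter k (mul v) (v ** (u ** u)) + iter k.+2 (mul v) u *+ 2 + iter k (mul v) (v ** (v ** v)).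
Proof.
by elim: k => //= k ->; rewrite mul_cube_terms.
Qed.

Let mul_iter_cube v u k : V v -> U u -> u ** iter k (mul v) (cube v u) = 0.
Proof.
move=> vV uU; have uuV : V (u ** u) by exact: peirceUU.
have := mul_iter_VV k.+1 vV uU vV vV; rewrite iterSr => h.
by rewrite iter_cubeE mul_cube_terms mul_iter_self // mul_iter_VV // h mul0rn !add0r.
Qed.

Let sub_double (x y z : A) : x - y *+ 2 + z = x + y *+ 2 + z - y *+ 4.
Proof.
rewrite [RHS]addrAC -[RHS]addrA -[LHS]addrA -[in RHS]addrA; congr (_ + _).
by rewrite (mulrnDr y 2 2); move: (y *+ 2) => a; rewrite opprD -addrA addNKr.
Qed.

(** Each iterate of [cube v u] is killed by [u], so multiplication by [u + v] acts on it as
    [L_v]. *)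
Let cube_power v u k : V v -> U u ->
  iter k (mul (u + v)) ((u + v) ** ((u + v) ** (u + v))) = iter k (mul v) (cube v u).
Proof.
move=> vV uU; elim: k => [|k IHk]; last first.
  by rewrite !iterS IHk mulDl mul_iter_cube ?add0r.
have uvU : U (v ** u) by exact: peirceVU.
rewrite /= (mul_sqrD) (mulC u v) mulDl !mul_cube_terms.
rewrite peirceU_cube // peirceU_VU //.
by rewrite peirceU_VV // mul0rn !add0r.
Qed.

Let algebraic_cube v u : V v -> U u -> algebraic_elt mul (u + v) ->
  exists P : {poly K}, P != 0 /\ poly_op P (mul v) (cube v u) = 0.
Proof.
move=> vV uU [n /has_dim_basis[b [_ _ sb]]]; apply: (@dep_iter_poly _ _ _ n.+1).
move=> ix; have /steinitz : forall i, (i < n.+1)%N ->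
    spanned n b (iter i (mul v) (cube v u)).
  move=> i _; rewrite -cube_power //; apply: sb => B [[_ _ _ BM] Ba].
  have Bx : B (u + v) by exact: Ba.
  by elim: i => [|i IHi]; [apply: (BM) => //; apply: BM | apply: BM].
by move/(_ ix); rewrite ltnn.
Qed.

Lemma algebraic_locally u v : algebraic_algebra mul -> U u -> V v ->
  locally_algebraic_on v u.
Proof.
move=> algA uU vV; have NU : U (- u) by exact: peirceUN.
have U0 : U 0 by rewrite /peirceU /= mul0r scaler0.
have [P0 [nz0 P0E]] := algebraic_cube vV U0 (algA _).
have [P1 [nz1 P1E]] := algebraic_cube vV uU (algA _).
have [P2 [nz2 P2E]] := algebraic_cube vV NU (algA _).
have killM P Q x : poly_op P (mul v) x = 0 -> poly_op (Q * P) (mul v) x = 0.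
  by move=> Px; rewrite poly_opM Px poly_op0r.
pose Q := P0 * P1 * P2.
have Q0 : poly_op Q (mul v) (cube v 0) = 0.
  by rewrite /Q -mulrA mulrC killM.
have Q1 : poly_op Q (mul v) (cube v u) = 0.
  by rewrite /Q mulrAC killM.
have Q2 : poly_op Q (mul v) (cube v (- u)) = 0.
  by rewrite /Q killM.
have QX : poly_op Q (mul v) (v ** (v ** u)) = 0.
  (* The only term of [cube v u] odd in [u] is [2 v (v u)], so changing the sign of [u] changes the
     cube by four times [v (v u)]. *)
  have E : v ** (v ** u) = 4%:R^-1 *: (cube v u - cube v (- u)).
    have -> : cube v (- u) = cube v u - v ** (v ** u) *+ 4.
      rewrite /cube !(mulNl, mulNr, opprK, mulNrn).
      exact: sub_double.
    by rewrite subKr -(scaler_nat 4 (v ** (v ** u))) scalerA mulVf ?pnatr_eq0 ?scale1r.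
  by rewrite E poly_opZr -[- cube _ _]scaleN1r poly_opDr poly_opZr Q1 Q2 scaler0 addr0 scaler0.
(* The factor ['X^2] absorbs the two multiplications by [v] in [v (v u)]. *)
exists (size (Q * 'X^2)); apply: poly_dep_iter.
  by rewrite mulf_neq0 ?expf_neq0 ?polyX_eq0 // !mulf_neq0.
by rewrite poly_opM poly_op_XnE.
Qed.

(** * A finite spanning family for a one-generated subalgebra *)

Lemma spanned_mul n b x y : spanned n b x -> spanned n b y ->
  (forall i j, (i < n)%N -> (j < n)%N -> spanned n b (b i ** b j)) ->
  spanned n b (x ** y).
Proof.
move=> [c ->] [d ->] bb; rewrite linear_sumlz; apply: spanned_sum => i _.
rewrite mulZl; apply: spannedZ; rewrite linear_sum; apply: spanned_sum => j _.
by rewrite /= mulZr; apply/spannedZ/bb.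
Qed.

Lemma alg_spanned N a : (forall u v, U u -> V v ->
    ~ indep N (fun i => iter i (mul v) u)) ->
  exists b, forall x, alg mul a x -> spanned (3 + 3 * N) b x.
Proof.
move=> dN; have [u [v [uU vV aE]]] := peirce_decomposition a.
have uuV : V (u ** u) by exact: peirceUU.
have vvU : U (v ** v) by exact: peirceVV.
have wU : U (v ** (u ** u)) by exact: peirceVV.
pose T := mul v.
(* Three single elements and three orbits cut at [N], whence [3 + 3 * N]. *)
pose s := [:: e; v; u ** u] ++ [seq iter k T u | k <- iota 0 N] ++
  [seq iter k T (v ** v) | k <- iota 0 N] ++
  [seq iter k T (v ** (u ** u)) | k <- iota 0 N].
have ss : size s = (3 + 3 * N)%N.
  by rewrite /s !size_cat !size_map !size_iota /= !mulSn mul0n addn0.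
pose b := nth 0 s; exists b; rewrite -ss.
pose B := spanned (size s) b.
have sB x : x \in s -> B x.
  by move=> xs; rewrite /B -(nth_index 0 xs); apply: spanned_mem; rewrite index_mem.
have TB k x : U x -> (forall k, (k < N)%N -> iter k T x \in s) -> B (iter k T x).
  move=> xU xs; apply: spanned_trans (iter_spanned (dN x v xU vV) k) => i ltiN.
  by apply/sB/xs.
pose gT x := x = u \/ x = v ** v \/ x = v ** (u ** u).
have gTU x : gT x -> U x by move=> [->|[->|->]].
have gTB k x : gT x -> B (iter k T x).
  move=> gx; apply: TB; first exact: gTU.
  move=> {}k kN; rewrite /s !mem_cat; have kI : k \in iota 0 N by rewrite mem_iota.
  by move: gx => [->|[->|->]]; rewrite (map_f (fun k => iter k T _) kI) ?orbT.
have gTM k x w : x = v ** v \/ x = v ** (u ** u) -> U w -> w ** iter k T x = 0.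
  by move=> [->|->] wU'; apply: mul_iter_VV.
(* The orbits are not cut here: they stay in [B] by [iter_spanned], and stability under [L_v]
   becomes immediate. *)
pose gen x := x = e \/ x = v \/ x = u ** u \/ exists k z, gT z /\ x = iter k T z.
have genB x : gen x -> B x.
  move=> [->|[->|[->|[k [z [gz ->]]]]]]; last exact: gTB.
  - by apply: sB; rewrite mem_head.
  - by apply: sB; rewrite !inE eqxx orbT.
  - by apply: sB; rewrite !inE eqxx !orbT.
have B0 : B 0 by exact: spanned0.
have BM x y : gen x -> gen y -> B (x ** y).
  have eg k z : gT z -> B (e ** iter k T z).
    move=> gz; have /peirceU_double h := iter_peirceVU k vV (gTU z gz).
    have -> : e ** iter k T z = 2%:R^-1 *: iter k T z.
      by rewrite -[in RHS]h -(scaler_nat 2 (e ** _)) scalerA mulVf ?pnatr_eq0 // scale1r.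
    by apply/spannedZ/gTB.
  have ug k z : gT z -> u ** u ** iter k T z = 0.
    move=> [->|gz]; first exact: sqr_mul_iter.
    rewrite peirceU_sqr_mul ?gTM ?mul0r ?oppr0 ?mul0rn //.
    by apply: iter_peirceVU => //; apply: gTU; right.
  have vg k z : gT z -> B (v ** iter k T z).
    by move=> gz; exact: (gTB k.+1).
  (* Only two iterates of [u] can have a nonzero product: up to sign it is [u] times iterate
     [k + k'] of [u], which is [u^2] for exponent 0 and zero otherwise. *)
  have gg k z k' z' : gT z -> gT z' -> B (iter k T z ** iter k' T z').
    move=> gz; have TzU := iter_peirceVU k vV (gTU z gz).
    move=> [->|gz']; last by rewrite gTM.
    case: gz => [->|gz].
      rewrite (mul_iter_skew _ vV (iter_peirceVU k vV uU) uU) -iterD; apply: spannedZ.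
      rewrite mulC; case: (k' + k)%N => [|l]; last by rewrite mul_iter_self.
      by apply: genB; right; right; left.
    by rewrite mulC gTM //; apply: iter_peirceVU.
  move=> [->|[->|[->|[k [z [gz ->]]]]]] [->|[->|[->|[k' [z' [gz' ->]]]]]].
  - by rewrite ee; apply: genB; left.
  - by rewrite vV.
  - by rewrite uuV.
  - exact: eg.
  - by rewrite mulC vV.
  - by apply: (gTB 0%N); right; left.
  - by apply: (gTB 0%N); right; right.
  - exact: vg.
  - by rewrite mulC uuV.
  - by rewrite mulC; apply: (gTB 0%N); right; right.
  - by rewrite weight0_sqr_sqr // (weightU uU).
  - by rewrite ug.
  - by rewrite mulC; exact: eg.
  - by rewrite mulC; exact: vg.
  - by rewrite mulC ug.
  - exact: gg.
have sgen x : x \in s -> gen x.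
  rewrite /s !mem_cat !inE => /or4P[/or3P[]/eqP->|||].
  - by left.
  - by right; left.
  - by right; right; left.
  - by move=> /mapP[k _ ->]; right; right; right; exists k, u; split=> //; left.
  - move=> /mapP[k _ ->]; right; right; right; exists k, (v ** v); split=> //.
    by right; left.
  - move=> /mapP[k _ ->]; right; right; right; exists k, (v ** (u ** u)).
    by split=> //; right; right.
have Ba : B a.
  rewrite aE; apply: spannedD; first apply: spannedD.
  - by apply: spannedZ; apply: genB; left.
  - by apply: genB; right; right; right; exists 0%N, u; split=> //; left.
  - by apply: genB; right; left.
move=> x; apply; split; last by move=> _ ->.
split=> //.
- by move=> y z; exact: spannedD.
- by move=> c y; exact: spannedZ.
- move=> y z By Bz; apply: spanned_mul => // i j ltis ltjs.
  by apply: BM; apply: sgen; apply: mem_nth.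
Qed.

End PeirceIdentities.

(** * Uniform bound on the length of orbits *)

Section UniformDegree.
Local Open Scope classical_set_scope.
Context {K : numFieldType} {A : completeNormedModType K}.
Context (mul : {bilinear A -> A -> A}) (omega : {scalar A}) (e : A).
Context (ban : is_banach_bernstein mul omega) (e_neq0 : e != 0) (ee : mul e e = e).

Let bern := banach_bernstein_bernstein ban.
Local Notation U := (peirceU mul e).
Local Notation V := (peirceV mul e).

Lemma continuous_mul (f g : A -> A) : continuous f -> continuous g ->
  continuous (fun x => mul (f x) (g x)).
Proof.
move=> cf cg x; apply/cvgrPdist_lt => eps eps0.
(* The summands of [M] are the weights of the three error terms below; the product of differences
   gets weight 1 because [f y] is within 1 of [f x]. *)
pose M := 1 + `|f x| + `|g x|.
have M0 : 0 < M by rewrite /M -addrA ltr_pwDl // addr_ge0.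
have d0 : 0 < eps / M by rewrite divr_gt0.
near=> y.
have fy : `|f x - f y| < eps / M.
  by near: y; move/cvgrPdist_lt: (cf x); apply.
have gy : `|g x - g y| < eps / M.
  by near: y; move/cvgrPdist_lt: (cg x); apply.
have fy1 : `|f x - f y| < 1.
  by near: y; move/cvgrPdist_lt: (cf x); apply.
have -> : mul (f x) (g x) - mul (f y) (g y) =
    mul (f x - f y) (g x) + (mul (f x) (g x - g y) - mul (f x - f y) (g x - g y)).
  have -> : mul (f x) (g x - g y) - mul (f x - f y) (g x - g y) = mul (f y) (g x - g y).
    by rewrite -linearBl subKr.
  by rewrite linearBl linearB /= addrA subrK.
have nM := banach_bernstein_normM ban.
apply: le_lt_trans (_ : eps / M * `|g x| + (`|f x| * `|g x - g y| + `|g x - g y|) < _).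
  apply: le_trans (ler_normD _ _) _; apply: lerD.
    by apply: le_trans (nM _ _) _; rewrite ler_wpM2r // ltW.
  apply: le_trans (ler_normB _ _) _; apply: lerD; first exact: nM.
  apply: le_trans (nM _ _) _; rewrite -[leRHS]mul1r ler_wpM2r //.
  exact: ltW.
have epsE : eps = eps / M * `|g x| + (1 + `|f x|) * (eps / M).
  by rewrite [_ * (eps / M)]mulrC -mulrDr [`|g x| + _]addrC -/M divfK ?gt_eqF.
have -> : `|f x| * `|g x - g y| + `|g x - g y| = (1 + `|f x|) * `|g x - g y|.
  by rewrite mulrDl mul1r addrC.
by rewrite [ltRHS]epsE ltrD2l ltr_pM2l // ltr_pwDl.
Unshelve. all: by end_near.
Qed.

(** The Peirce projections put all pairs of [u] and [v] into the single complete space [A], on which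
    orbits are continuous and polynomial along lines. *)
Let iterate (i : nat) (a : A) : A := iter i (mul (projV mul e a)) (projU mul e a).

Lemma continuous_iterate i : continuous (iterate i).
Proof.
have cid : continuous (fun x : A => x) by move=> x; exact: cvg_id.
have ccst (c : A) : continuous (fun _ : A => c) by move=> x; exact: cvg_cst.
have ce := continuous_mul (ccst e) cid; have cee := continuous_mul (ccst e) ce.
have cZ (k : K) f : continuous f -> continuous (fun x : A => k *: (f x : A)).
  by move=> cf x; apply: cvgZr; exact: cf.
have cB (f g : A -> A) : continuous f -> continuous g -> continuous (fun x => f x - g x).
  by move=> cf cg x; apply: cvgB; [exact: cf|exact: cg].
have cD (f g : A -> A) : continuous f -> continuous g -> continuous (fun x => f x + g x).
  by move=> cf cg x; apply: cvgD; [exact: cf|exact: cg].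
have cU : continuous (projU mul e) by apply/cZ/cB.
have cV : continuous (projV mul e).
  by apply: cD; [apply: cB => //; exact: cZ | exact: cZ].
elim: i => [|i IHi]; first exact: cU.
exact: (continuous_mul cV IHi).
Qed.

Lemma polyfun_iterate i x y : polyfun (fun t => iterate i (x + t *: y)).
Proof.
have cxy : polyfun (fun t => x + t *: y).
  apply: polyfunD; first exact: polyfun_cst.
  by apply: eq_polyfun (polyfun_mon 1 y) => t; rewrite expr1.
have ce := polyfun_mul mul (polyfun_cst e) cxy.
have cee := polyfun_mul mul (polyfun_cst e) ce.
have cB (f g : K -> A) : polyfun f -> polyfun g -> polyfun (fun x => f x - g x).
  move=> pf pg; apply: eq_polyfun (polyfunD pf (polyfunZ (-1) pg)) => t.
  by rewrite scaleN1r.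
have cU : polyfun (fun t => projU mul e (x + t *: y)) by apply/polyfunZ/cB.
have cV : polyfun (fun t => projV mul e (x + t *: y)).
  by apply: polyfunD; [apply: cB => //; exact: polyfunZ | exact: polyfunZ].
elim: i => [|i IHi]; first exact: cU.
exact: (polyfun_mul mul cV IHi).
Qed.

Lemma locally_algebraic_uniform : invS_cvg0 K -> seq_complete K ->
  (forall u v, U u -> V v -> locally_algebraic_on mul v u) ->
  exists N, forall u v, U u -> V v -> ~ indep N (fun i => iter i (mul v) u).
Proof.
move=> invS0 cK loc; pose F n a := indep n (iterate^~ a).
(* A ball missed by [F n] suffices: independence at [u + v] would persist on the line towards the
   centre [x] outside finitely many parameters, hence somewhere in the ball. *)
suff [n [x [r r0 xF]]] : exists n x, exists2 r : K, 0 < r &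
    forall y, `|x - y| < r -> ~ F n y.
  exists n => u v uU vV iuv.
  have ia : F n (x + 1 *: ((u + v) - x)).
    rewrite scale1r addrC subrK /F /iterate.
    by rewrite (projU_peirce ee) // (projV_peirce ee).
  have [|q [q1 qF]] := @indep_polyfun _ _ n
    (fun i t => iterate i (x + t *: ((u + v) - x))) 1 _ ia.
    by move=> i; exact: polyfun_iterate.
  have q0 : q != 0 by apply: contraNneq q1 => ->; rewrite horner0.
  have M0 : 0 < 1 + `|u + v - x| by rewrite ltr_pwDl.
  have [|t [t0 tr /qF]] := exists_nonroot (d := r / (1 + `|u + v - x|)) q0.
    by rewrite divr_gt0.
  apply: xF; rewrite opprD addNKr normrN normrZ gtr0_norm //.
  rewrite ltr_pdivlMr // in tr; apply: le_lt_trans tr.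
  by rewrite ler_pM2l // lerDr.
apply: contrapT => nF.
(* Otherwise every [F n] is dense; being open as well, they have a common point. *)
have [|n x r r0|a aF] := @baire_numField K A F invS0 (@seq_complete_completeNormedMod K A).
- move=> n x iF; have [d d0 dF] := indep_near invS0 cK iF.
  have : \forall y \near x, forall i : 'I_n, `|iterate i x - iterate i y| < d.
    apply: filter_forall => i.
    by move/cvgrPdist_lt: (@continuous_iterate i x); apply.
  move=> /nbhs_ballP[r /= r0 rF]; exists r => // y xy; apply: dF => i ltin.
  by apply: (rF y _ (Ordinal ltin)); rewrite -ball_normE.
- apply: contrapT => nx; apply: nF; exists n, x, r => // y xy yF.
  by apply: nx; exists y.
(* At a common point the orbit would be independent at every length, against local algebraicity. *)
- have [n dn] := loc _ _ (projUP bern e_neq0 ee a) (projVP bern e_neq0 ee a).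
  exact: dn (aF n).
Qed.

End UniformDegree.

Theorem theorem5p1 (R : realType) (K : numFieldType)
    (hK : K = R :> numFieldType \/ K = R[i] :> numFieldType)
    (A : completeNormedModType K)
    (mul : {bilinear A -> A -> A}) (omega : {scalar A})
    (hA : is_banach_bernstein mul omega)
    (e : A) (e_neq0 : e != 0) (e_idem : mul e e = e) :
  [<-> algebraic_algebra mul;
       peirce_ops_algebraic mul e;
       algebraic_algebra_bounded mul;
       peirce_ops_algebraic_bounded mul e].
Proof.
have [invS0 cK] : invS_cvg0 K /\ seq_complete K.
  case: hK => KE; subst K; split.
  - exact: invS_cvg0_real.
  - exact: seq_complete_real.
  - exact: invS_cvg0_complex.
  - exact: seq_complete_complex.
have bern := banach_bernstein_bernstein hA.
have unif := locally_algebraic_uniform hA e_neq0 e_idem invS0 cK.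
have opU : peirce_ops_algebraic mul e -> forall u v, peirceU mul e u ->
    peirceV mul e v -> locally_algebraic_on mul v u.
  move=> opA u v uU vV; have [P [P0 PU]] := opA v vV; exists (size P).
  exact: poly_dep_iter P0 (PU u uU).
(* A common bound on local degrees yields one polynomial valid on all of [U], of degree at most
   [2 N]. *)
have opB N : (forall u v, peirceU mul e u -> peirceV mul e v ->
    ~ indep N (fun i => iter i (mul v) u)) -> forall v, peirceV mul e v ->
    exists P : {poly K}, [/\ P != 0, annihilates_on (peirceU mul e) (mul v) P
      & ((size P).-1 <= N.*2)%N].
  move=> dN v vV; apply: locally_algebraic_bounded => [t x y xU yU|x xU].
    exact: peirceUD xU (peirceUZ t yU).
  exact: dN.
split; [|split; [|split]].
(* Even this implication goes through the uniform bound: algebraic elements give one polynomial per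
   [u], while [L_v] needs one for all of [U]. *)
- move=> algA v vV.
  have [N dN] := unif (fun u v uU vV => algebraic_locally bern e_neq0 e_idem algA uU vV).
  by have [P [P0 PU _]] := opB N dN v vV; exists P.
- move=> /opU/unif[N /(alg_spanned bern e_neq0 e_idem) dN]; split=> [a|].
    by have [b sb] := dN a; exact: has_dim_exists sb.
  by exists (3 + 3 * N)%N => a n; have [b sb] := dN a; exact: has_dim_le sb.
- move=> [algA _].
  have [N dN] := unif (fun u v uU vV => algebraic_locally bern e_neq0 e_idem algA uU vV).
  split=> [v vV|]; first by have [P [P0 PU _]] := opB N dN v vV; exists P.
  exists N.*2 => v vV d [_ dmin]; have [P [P0 PU sP]] := opB N dN v vV.
  exact: leq_trans (dmin P P0 PU) sP.
- move=> [/opU/unif[N /(alg_spanned bern e_neq0 e_idem) dN] _] a.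
  by have [b sb] := dN a; exact: has_dim_exists sb.
Qed.
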